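(* Let $s_{2n}^*$ be the even moments of the symmetric moment problem given by $b_{2n}^*=\sqrt{3n+1}\,(3n+2)$ ($n\ge0$), $b_{2n-1}^*=3n\sqrt{3n+1}$ ($n\ge1$). Let $$\theta=\int_0^1\frac{du}{(1-u^3)^{2/3}},\qquad a=\theta^3 .$$ There exist constants $K_1,K_2>0$ such that $$K_1a^{-n}\,\Gamma(3n+3/2)<s_{2n}^*<K_2a^{-n}\,n\,\Gamma(3n+3/2),\qquad n\ge1 .$$ In particular $$\lim_{n\to\infty}\frac{\sqrt[n]{s_{2n}^*}}{n^3}=\frac{27}{a e^3}=\Big(\frac{3}{e\theta}\Big)^3$$ and $$\lim_{n\to\infty}\sqrt[n]{U_n^*}=\Big(\frac{2}{\theta}\Big)^3 .$$
   Context: Given positive numbers $(b_n)_{n\ge0}$, let $P_{-1}=0$, $P_0=1$ and $xP_n(x)=b_nP_{n+1}(x)+b_{n-1}P_{n-1}(x)$, $n\ge0$ (the value of $b_{-1}$ is irrelevant). There is a probability measure $\mu$ on $\mathbb{R}$ with infinite support and all moments for which $(P_n)$ are the orthonormal polynomials; its moments $s_n=\int x^n\,d\mu$ depend only on $(b_n)$ and are the moments of the symmetric moment problem given by $(b_n)$. Put $U_n=\dfrac{s_{2n}}{b_0^2b_1^2\cdots b_{n-1}^2}$ for $n\ge1$. A star denotes these quantities for $b_n=b_n^*$. $\Gamma$ is the Gamma function; $\theta=\frac13B(1/3,1/3)=\frac{\Gamma(1/3)^3}{2\pi\sqrt3}$. *)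

(* Defs.v *)
From HB Require Import structures.
From mathcomp Require Import all_boot all_order all_algebra.
From mathcomp Require Import all_classical all_reals all_analysis.
Set Implicit Arguments.
Unset Strict Implicit.
Unset Printing Implicit Defensive.
Import Order.TTheory GRing.Theory Num.Theory.
Import numFieldNormedType.Exports.
Local Open Scope classical_set_scope.
Local Open Scope ring_scope.

(* Computes the pair (P_{n-1}, P_n), starting from (P_{-1}, P_0) = (0, 1);
   since P_{-1} = 0, the use of [b 0] for the irrelevant b_{-1} is harmless. *)
Fixpoint opoly_pair (R : fieldType) (b : nat -> R) (n : nat) :
    {poly R} * {poly R} :=
  if n is m.+1 then
    let: (p, q) := opoly_pair b m in
    (q, (b m)^-1 *: ('X * q - b m.-1 *: p))
  else (0, 1).

Definition opoly (R : fieldType) (b : nat -> R) (n : nat) : {poly R} :=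
  (opoly_pair b n).2.

Lemma opoly0 (R : fieldType) (b : nat -> R) : opoly b 0 = 1.
Proof. by []. Qed.

Lemma opoly_rec0 (R : fieldType) (b : nat -> R) (b0 : b 0%N != 0) :
  'X * opoly b 0 = b 0%N *: opoly b 1.
Proof. by rewrite /opoly /= scaler0 subr0 scalerA mulfV // scale1r. Qed.

Lemma opoly_rec (R : fieldType) (b : nat -> R) (n : nat) (bn : b n.+1 != 0) :
  'X * opoly b n.+1 = b n.+1 *: opoly b n.+2 + b n *: opoly b n.
Proof.
rewrite /opoly /=; case: (opoly_pair b n) => p q /=.
by rewrite scalerA mulfV // scale1r subrK.
Qed.

Definition msupport (R : realType) (mu : {measure set (measurableTypeR R) -> \bar R})
    : set R :=
  [set x | forall U : set R, open U -> U x -> (0 < mu U)%E].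

Definition has_all_moments (R : realType)
    (mu : {measure set (measurableTypeR R) -> \bar R}) : Prop :=
  forall n : nat, mu.-integrable setT (fun x : R => (x ^+ n)%:E).

Definition orthonormal_polys (R : realType)
    (mu : {measure set (measurableTypeR R) -> \bar R}) (P : nat -> {poly R}) : Prop :=
  forall m n : nat,
    (\int[mu]_(x in setT) ((P m).[x] * (P n).[x]) = (m == n)%:R :> R)%R.

(* [s] is the moment sequence of the symmetric moment problem given by [b].
   The representing measure need not be unique, but [s] is. *)
Definition symmetric_moments (R : realType) (b s : nat -> R) : Prop :=
  exists mu : probability (measurableTypeR R) R,
    [/\ infinite_set (msupport mu),
        has_all_moments mu,
        orthonormal_polys mu (opoly b) &
        forall n : nat, s n = (\int[mu]_(x in setT) (x ^+ n))%R].

Definition Useq (R : realType) (b s : nat -> R) (n : nat) : R :=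
  s (2 * n)%N / \prod_(i < n) b i ^+ 2.

Definition Gamma (R : realType) (z : R) : R :=
  (\int[@lebesgue_measure R]_(t in `]0%R, +oo[) (t `^ (z - 1) * expR (- t)))%R.

(* Open interval: [powR] takes the value 0 at base 0 and nonzero exponent. *)
Definition theta (R : realType) : R :=
  (\int[@lebesgue_measure R]_(u in `]0%R, 1%R[) ((1 - u ^+ 3) `^ (2%:R / 3%:R))^-1)%R.

(* [uphalf k] is m both for k = 2m and for k = 2m - 1. *)
Definition bstar (R : realType) (k : nat) : R :=
  let m := uphalf k in
  if odd k then (3 * m)%:R * Num.sqrt (3 * m + 1)%:R
  else Num.sqrt (3 * m + 1)%:R * (3 * m + 2)%:R.

Lemma bstar_even (R : realType) (n : nat) :
  bstar R (2 * n) = Num.sqrt (3 * n + 1)%:R * (3 * n + 2)%:R.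
Proof. by rewrite /bstar mul2n odd_double uphalf_double. Qed.

Lemma bstar_odd (R : realType) (n : nat) (n1 : (1 <= n)%N) :
  bstar R (2 * n - 1) = (3 * n)%:R * Num.sqrt (3 * n + 1)%:R.
Proof.
case: n n1 => // n _.
by rewrite /bstar mul2n doubleS subn1 /= odd_double /= doubleK.
Qed.

(* Main.v *)
Require Import Defs.
From HB Require Import structures.
From mathcomp Require Import all_boot all_order all_algebra.
From mathcomp Require Import all_classical all_reals all_analysis.
From mathcomp Require Import measurable_realfun.
From mathcomp Require Import ring lra zify.
Import Order.TTheory GRing.Theory Num.Theory.
Import numFieldNormedType.Exports.
Local Open Scope classical_set_scope.
Local Open Scope ring_scope.

(* The function f = sum_n s_{2n} x^(3n+1) / (3n+1)! solves f' = g^2, g' = f^2, f(0) = 0,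
   g(0) = 1 (Dixon's elliptic functions; g^3 = 1 + f^3): both x^2 acting on the
   P_{2k} and d^3/dx^3 acting on the f^(3k+1) obey the same three-term relation.
   One has f = x / E(x^3) and g = E(-x^3) / E(x^3) for a power series E whose
   coefficients p_n, computed from 3 y E'(y) = E(y) - E(-y)^2 and p_1 = -1/6, are at
   most 3/18^n in size.  The first positive zero a of E is theta^3: the function
   sm x = x / E(-x^3) maps [0, a^(1/3)] onto [0, 1] and
   sm' = (1 - sm^3)^(2/3).  With d_n = s_{2n} a^n / (3n+1)!, dividing E(a z) by 1 - z
   turns E * (1/E) = 1 into sum_k h_k d_{n-k} = 1, where h_k is the k-th partial sum
   of E(a) = 0 and sum_{k >= 1} |h_k| < 1/2; so d_n stays between two positive
   constants, and everything follows from factorial estimates. *)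

(** Three obstacles shape the route. (1) f and 1/E are singular at the very point that matters, so
    they are used only as formal series, represented by polynomials modulo ['X^N]; only E and E' are
    evaluated, and formal identities for E become real ones through a geometric tail estimate. (2)
    Integrating f' = (1 + f^3)^(2/3) along x > 0 runs into the pole of f. The reflected functions sm
    x = -f(-x) and cm x = g(-x) stay bounded: sm^3 + cm^3 = 1, and cm vanishes where E(x^3) does, so
    the first zero of E marks the upper end u = 1 of the integral theta. (3) A pole asymptotic of
    1/E at a would call for complex analysis. Two-sided bounds need only the renewal equation of the
    h_k: if the |h_k| with k >= 1 add up to at most rho < 1, then |d_n| <= 1/(1 - rho) by strong
    induction, hence d_n >= 1 - rho/(1 - rho), and this is positive exactly for rho < 1/2. *)

(* Course-of-values recursion: [dixon_upto n] is the coefficient sequence of E up to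
   index n - 1, and 0 beyond. *)
Fixpoint dixon_upto (R : realType) (n : nat) : nat -> R :=
  if n is m.+1 then fun i =>
    if i == m then
      if (m <= 1)%N then (- 6^-1) ^+ m
      else - (-1) ^+ m * (\sum_(1 <= j < m) dixon_upto R m j * dixon_upto R m (m - j))
             / ((3 * m)%:R - 1 + 2 * (-1) ^+ m)
    else dixon_upto R m i
  else fun=> 0.

Definition dixon_coef (R : realType) (n : nat) : R := dixon_upto R n.+1 n.

Lemma dixon_uptoE (R : realType) n i :
  (i < n)%N -> dixon_upto R n i = dixon_coef R i.
Proof.
rewrite /dixon_coef; elim: n => // n IH; rewrite ltnS leq_eqVlt => /orP[/eqP->//|lin].
by rewrite [LHS]/= ltn_eqF // IH.
Qed.

Lemma dixon_coef0 (R : realType) : dixon_coef R 0 = 1.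
Proof. by rewrite /dixon_coef /= expr0. Qed.

Lemma dixon_coef1 (R : realType) : dixon_coef R 1 = - 6^-1.
Proof. by rewrite /dixon_coef /= expr1. Qed.

Lemma dixon_denom_ge (R : realType) n : (2 <= n)%N ->
  3 * (n%:R - 1) <= (3 * n)%:R - 1 + 2 * (-1) ^+ n :> R.
Proof.
move=> n2; have : (-1 : R) <= (-1) ^+ n.
  by rewrite -signr_odd; case: (odd n); rewrite ?expr1 ?expr0; lra.
rewrite natrM; lra.
Qed.

Lemma dixon_coef_rec (R : realType) n : (2 <= n)%N ->
  dixon_coef R n = - (-1) ^+ n *
    (\sum_(1 <= j < n) dixon_coef R j * dixon_coef R (n - j))
    / ((3 * n)%:R - 1 + 2 * (-1) ^+ n).
Proof.
move=> n2; rewrite {1}/dixon_coef /= eqxx leqNgt n2 /=; congr (_ * _ / _).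
apply: eq_big_nat => j /andP[j1 jn]; rewrite !dixon_uptoE//; lia.
Qed.

(** This is 3 y E' = E - E(-y)^2 read off at y^n; the end terms j = 0 and j = n, moved to the left,
    produce the denominator of the recursion. At n = 1 that denominator vanishes, so the equation
    leaves p_1 free. *)
Lemma dixon_coef_conv (R : realType) n :
  ((3 * n)%:R - 1) * dixon_coef R n =
  - (-1) ^+ n * \sum_(j < n.+1) dixon_coef R j * dixon_coef R (n - j).
Proof.
case: n => [|[|n]].
- by rewrite big_ord1 dixon_coef0 muln0 expr0; ring.
- by rewrite !big_ord_recr big_ord0 /= dixon_coef0 dixon_coef1; field.
rewrite big_ord_recr big_ord_recl /= subn0 subnn dixon_coef0.
under eq_bigr do rewrite /bump /=.
rewrite -(big_mkord predT (fun i => dixon_coef R (1 + i) * dixon_coef R (n.+2 - (1 + i)))).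
under eq_bigr do rewrite add1n.
rewrite -(big_add1 _ _ 0%N n.+2 predT (fun i => dixon_coef R i * dixon_coef R (n.+2 - i))).
have := dixon_coef_rec R n.+2 isT; have := dixon_denom_ge R n.+2 isT.
set S := \sum_(1 <= j < n.+2) _; set D := _ + 2 * _; set c := dixon_coef R n.+2 => D0 cE.
have {}D0 : D != 0.
  apply: lt0r_neq0; apply: lt_le_trans D0; rewrite pmulr_rgt0 // subr_gt0 ltr1n //.
have cD : c * D = - (-1) ^+ n.+2 * S by rewrite cE divfK.
rewrite [_ * c in LHS](_ : _ = c * D - 2 * (-1) ^+ n.+2 * c); last by rewrite /D; ring.
by rewrite cD; ring.
Qed.

(** The ansatz C r^n reproduces itself: n - 1 products of size C^2 r^n over a denominator of at
    least 3(n - 1) give back C r^n for C = 3, and then |p_1| = 1/6 dictates r = 1/18. *)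
Lemma dixon_coef_bound (R : realType) n : (0 < n)%N ->
  `|dixon_coef R n| <= 3 / 18 ^+ n.
Proof.
elim/ltn_ind: n => -[//|[|n]] IH _.
  by rewrite dixon_coef1 normrN ger0_norm ?expr1 //; lra.
rewrite dixon_coef_rec //; have := dixon_denom_ge R n.+2 isT.
set D := _ + 2 * _ => Dge.
have n0 : 0 < n.+2%:R - 1 :> R by rewrite subr_gt0 ltr1n.
have D0 : 0 < D by apply: lt_le_trans Dge; rewrite pmulr_rgt0.
rewrite normrM normrM normrN normrX normrN1 expr1n mul1r normfV (gtr0_norm D0).
rewrite ler_pdivrMr //; apply: le_trans (ler_norm_sum _ _ _) _.
apply: (@le_trans _ _ (\sum_(1 <= j < n.+2) 9 / 18 ^+ n.+2)).
  apply: ler_sum_nat => j /andP[j1 jn]; rewrite normrM.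
  apply: (@le_trans _ _ ((3 / 18 ^+ j) * (3 / 18 ^+ (n.+2 - j)))).
    by apply: ler_pM => //; apply: IH; lia.
  rewrite mulrACA -invfM -exprD subnKC ?(ltnW jn) //.
  by rewrite -natrM.
rewrite sumr_const_nat subn1 -[_ *+ _]mulr_natr.
apply: le_trans (ler_wpM2l _ Dge); last by rewrite divr_ge0 // exprn_ge0.
rewrite -(natrB _ (isT : (1 <= n.+2)%N)) subn1 /=.
by move: (18 ^+ n.+2)^-1 n.+1%:R => u v; rewrite (_ : 3 * u * (3 * v) = 9 * u * v) //; ring.
Qed.

(** * Power series as polynomials modulo ['X^N] *)

Definition small (R : comNzRingType) (N : nat) (q : {poly R}) : Prop :=
  exists r, q = r * 'X^N.

Lemma small_coefP (R : comNzRingType) N (q : {poly R}) :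
  small R N q <-> forall i, (i < N)%N -> q`_i = 0.
Proof.
split=> [[r ->] i iN|q0]; first by rewrite coefMXn iN.
exists (drop_poly N q); rewrite -[LHS](poly_take_drop N) -[RHS]add0r; congr (_ + _).
by apply/polyP => i; rewrite coef_take_poly coef0; case: ifP => // /q0.
Qed.

Lemma smallW (R : comNzRingType) M N (q : {poly R}) :
  (M <= N)%N -> small R N q -> small R M q.
Proof.
by move=> MN [r ->]; exists (r * 'X^(N - M)); rewrite -mulrA -exprD subnK.
Qed.

Lemma smallD (R : comNzRingType) N (q1 q2 : {poly R}) :
  small R N q1 -> small R N q2 -> small R N (q1 + q2).
Proof. by move=> [r ->] [t ->]; exists (r + t); rewrite mulrDl. Qed.

Lemma smallMl (R : comNzRingType) N (q1 q2 : {poly R}) :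
  small R N q2 -> small R N (q1 * q2).
Proof. by move=> [r ->]; exists (q1 * r); rewrite mulrA. Qed.

Lemma smallN (R : comNzRingType) N (q : {poly R}) : small R N q -> small R N (- q).
Proof. by rewrite -mulN1r; exact: smallMl. Qed.

Lemma smallMX (R : comNzRingType) N (q : {poly R}) :
  small R N.+1 (q * 'X) -> small R N q.
Proof.
move=> /small_coefP q0; apply/small_coefP => i iN.
by have := q0 i.+1 iN; rewrite coefMX.
Qed.

Lemma small_deriv (R : comNzRingType) N (q : {poly R}) :
  small R N.+1 q -> small R N q^`().
Proof.
by move=> /small_coefP q0; apply/small_coefP => i iN; rewrite coef_deriv q0 ?mul0rn.
Qed.

Lemma comp_polyXn (R : comNzRingType) n (q : {poly R}) : 'X^n \Po q = q ^+ n.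
Proof. by elim: n => [|n IH]; rewrite ?comp_polyC // exprSr comp_polyM comp_polyX IH -exprSr. Qed.

Lemma small_comp (R : comNzRingType) N (q r : {poly R}) :
  small R N q -> small R N (q \Po (r * 'X)).
Proof.
move=> [u ->]; exists ((u \Po (r * 'X)) * r ^+ N).
by rewrite comp_polyM comp_polyXn exprMn mulrA.
Qed.

(** * Formal identities for the truncations of E *)

Definition dixon_poly (R : realType) (N : nat) : {poly R} :=
  \poly_(i < N) dixon_coef R i.

Definition dixon_polyN (R : realType) (N : nat) : {poly R} :=
  \poly_(i < N) ((-1) ^+ i * dixon_coef R i).

Lemma dixon_poly_compN (R : realType) N :
  dixon_poly R N \Po - 'X = dixon_polyN R N.
Proof.
rewrite /dixon_poly poly_def raddf_sum /= /dixon_polyN poly_def; apply: eq_bigr => i _.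
rewrite comp_polyZ comp_polyXn (exprNn 'X) -[X in X * _](rmorph_sign (@polyC R)).
by rewrite mul_polyC scalerA mulrC.
Qed.

Lemma dixon_polyN_compN (R : realType) N :
  dixon_polyN R N \Po - 'X = dixon_poly R N.
Proof.
rewrite -dixon_poly_compN -comp_polyA -scaleN1r comp_polyZ comp_polyX scalerA.
by rewrite mulrNN mul1r scale1r comp_polyXr.
Qed.

Lemma dixon_poly_ode (R : realType) N :
  small R N (3 * 'X * (dixon_poly R N)^`() - dixon_poly R N + dixon_polyN R N ^+ 2).
Proof.
apply/small_coefP => i iN; rewrite coefD coefB -mulrA -polyC_natr coefCM coefXM.
have -> : (if i == 0 then 0 else (dixon_poly R N)^`()`_i.-1) = i%:R * dixon_coef R i.
  case: i iN => [|i] iN; first by rewrite mul0r.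
  by rewrite /= coef_deriv coef_poly iN mulr_natl.
rewrite expr2 coefM coef_poly iN.
have -> : \sum_(j < i.+1) (dixon_polyN R N)`_j * (dixon_polyN R N)`_(i - j) =
   (-1) ^+ i * \sum_(j < i.+1) dixon_coef R j * dixon_coef R (i - j).
  rewrite big_distrr; apply: eq_bigr => j _; have jN := leq_ltn_trans (leq_ord j) iN.
  rewrite !coef_poly jN (leq_ltn_trans (leq_subr _ _) iN) mulrACA -exprD subnKC //.
  exact: leq_ord.
have := dixon_coef_conv R i; rewrite natrM mulNr; move: (dixon_coef R i) ((-1) ^+ i * _) => p S H.
by rewrite -[S]opprK -H; ring.
Qed.

(** Substituting -X exchanges the two truncations in [dixon_poly_ode]. *)
Lemma dixon_polyN_ode (R : realType) N :
  small R N (3 * 'X * (dixon_polyN R N)^`() - dixon_polyN R N + dixon_poly R N ^+ 2).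
Proof.
have := small_comp _ _ _ (-1) (dixon_poly_ode R N); rewrite mulN1r.
rewrite comp_polyD comp_polyB !comp_polyM comp_polyX -[3]polyC_natr comp_polyC.
rewrite dixon_polyN_compN -dixon_poly_compN deriv_comp.
rewrite derivN derivX mulrN1 mulrN mulNr -mulrN expr2; apply.
Qed.

(** The two differential equations give X K' = K for the difference K, so (i - 1) K_i = 0. Every
    coefficient vanishes except possibly K_1 = -6 p_1 - 1, and this is where the value p_1 = -1/6
    comes from. *)
Lemma dixon_poly_cube (R : realType) N : (2 <= N)%N ->
  small R N (dixon_polyN R N ^+ 3 - dixon_poly R N ^+ 3 - 'X).
Proof.
move=> N2; set K := (X in small R N X).
have KX : small R N ('X * K^`() - K).
  have [r1 h1] := dixon_poly_ode R N; have [r2 h2] := dixon_polyN_ode R N.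
  exists (dixon_polyN R N ^+ 2 * r2 - dixon_poly R N ^+ 2 * r1).
  rewrite mulrBl -!mulrA -h1 -h2 /K !derivB derivX !deriv_exp /=.
  ring.
apply/small_coefP => i iN; have [->|i1] := eqVneq i 1%N; last first.
  move/small_coefP: KX => /(_ i iN); rewrite coefB coefXM; case: i iN i1 => [|i] iN i1.
    by rewrite sub0r => /eqP; rewrite oppr_eq0 => /eqP.
  rewrite coef_deriv /= -[X in _ - X](mulr1n K`_i.+1) -mulrnBr // subn1 /=.
  by move/eqP; rewrite mulrn_eq0 => /orP[|/eqP//]; case: i i1 iN.
have : K^`().[0] = 0.
  rewrite /K !derivB derivX !deriv_exp !hornerE /= !horner_coef0 !coef_deriv.
  rewrite !coef_poly N2 (ltnW N2) dixon_coef0 dixon_coef1; lra.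
by rewrite horner_coef0 coef_deriv.
Qed.

(** Truncated Neumann series: 1 - e has no constant term, so its N-th power is divisible by
    ['X^N]. *)
Lemma small_inverse (R : comNzRingType) N (e : {poly R}) :
  e`_0 = 1 -> exists u, small R N (e * u - 1).
Proof.
move=> e0; exists (\sum_(i < N) (1 - e) ^+ i).
have -> : e * (\sum_(i < N) (1 - e) ^+ i) - 1 = - (1 - e) ^+ N.
  by rewrite -[(1 - e) ^+ N](subrK 1) subrX1; ring.
apply: smallN; have /small_coefP[r ->] : forall i, (i < 1)%N -> (1 - e)`_i = 0.
  by move=> [|//] _; rewrite coefB coef1 e0 subrr.
by exists (r ^+ N); rewrite expr1 exprMn.
Qed.

(** * The formal pair (f, g) and third derivatives along it *)

Lemma small_compX3 (R : comNzRingType) N (q : {poly R}) :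
  small R N q -> small R N (q \Po 'X^3).
Proof. by rewrite (exprSr 'X 2); exact: small_comp. Qed.

Lemma small_Xderiv (R : comNzRingType) N (q : {poly R}) :
  small R N q -> small R N ('X * q^`()).
Proof.
move=> /small_coefP q0; apply/small_coefP => -[|i] iN; rewrite coefXM //= coef_deriv q0 //.
exact: mul0rn.
Qed.

Lemma small_compX3_ode (R : comNzRingType) N (p q : {poly R}) :
  small R N (3 * 'X * p^`() - p + q ^+ 2) ->
  small R N ('X * (p \Po 'X^3)^`() - (p \Po 'X^3) + (q \Po 'X^3) ^+ 2).
Proof.
move=> /small_compX3; rewrite comp_polyD comp_polyB !comp_polyM comp_polyX.
rewrite -[3]polyC_natr comp_polyC polyC_natr deriv_comp derivXn /= -mulr_natl.
congr (small _ _ _); ring.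
Qed.

(** Here [u] is a truncated 1/E, so [f] and [g] are truncations of x / E(x^3) and E(-x^3) / E(x^3).
    One order of precision is lost because the equation for g' is first obtained multiplied by X. *)
Lemma dixon_pair (R : realType) N (u : {poly R}) (N1 : (1 <= N)%N)
    (f := 'X * (u \Po 'X^3)) (g := (dixon_polyN R N.+1 \Po 'X^3) * (u \Po 'X^3)) :
  small R N.+1 (dixon_poly R N.+1 * u - 1) ->
  [/\ small R N (f^`() - g ^+ 2), small R N (g^`() - f ^+ 2)
     & small R N (g ^+ 3 - 1 - f ^+ 3)].
Proof.
move=> /small_compX3; rewrite comp_polyB comp_polyM comp_polyC {}/f {}/g.
have hE := small_compX3_ode _ _ _ _ (dixon_poly_ode R N.+1).
have hEb := small_compX3_ode _ _ _ _ (dixon_polyN_ode R N.+1).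
have N2 : (2 <= N.+1)%N by [].
have := small_compX3 _ _ _ (dixon_poly_cube R N.+1 N2).
rewrite !comp_polyB !comp_polyM comp_polyX.
move: (_ \Po 'X^3) (dixon_polyN _ _ \Po 'X^3) (u \Po _) hE hEb => e eb U hE hEb hK hU.
have hU' := small_Xderiv _ _ _ hU; rewrite derivB derivM derivC subr0 in hU'.
(* This is f' = g^2 for f = X U: differentiate e U = 1, then insert the equation of e. *)
have hXU : small R N.+1 ('X * U^`() + U - eb ^+ 2 * U ^+ 2).
  rewrite [X in small _ _ X](_ : _ = U * ('X * (e^`() * U + e * U^`()))
    + (- 'X * U^`() - U) * (e * U - 1)
    + - (U ^+ 2) * ('X * e^`() - e + eb ^+ 2)); last ring.
  by do ?apply: smallD; apply: smallMl.
split.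
- apply: (smallW _ _ _ _ (leqnSn N)); rewrite derivM derivX.
  by rewrite [X in small _ _ X](_ : _ = 'X * U^`() + U - eb ^+ 2 * U ^+ 2) //; ring.
- apply: smallMX; rewrite derivM.
  rewrite [X in small _ _ X](_ : _ = U * ('X * eb^`() - eb + e ^+ 2)
    + eb * ('X * U^`() + U - eb ^+ 2 * U ^+ 2)
    + U ^+ 2 * (eb ^+ 3 - e ^+ 3 - 'X ^+ 3)
    + U * e ^+ 2 * (e * U - 1)); last ring.
  by do ?apply: smallD; apply: smallMl.
- apply: (smallW _ _ _ _ (leqnSn N)).
  rewrite [X in small _ _ X](_ : _ = U ^+ 3 * (eb ^+ 3 - e ^+ 3 - 'X ^+ 3)
    + (e ^+ 2 * U ^+ 2 + e * U + 1) * (e * U - 1)); last ring.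
  by do ?apply: smallD; apply: smallMl.
Qed.

(* Chosen so that (q o f)''' = (dixonT q) o f along a solution of f' = g^2, g' = f^2,
   g^3 = 1 + f^3. *)
Definition dixonT (R : comNzRingType) (q : {poly R}) : {poly R} :=
  q^`()^`()^`() * (1 + 'X^3) ^+ 2 + 6 * q^`()^`() * 'X^2 * (1 + 'X^3)
  + q^`() * (4 * 'X + 6 * 'X^4).

(** From f' = g^2 come f'' = 2 g f^2 and f''' = 6 f^4 + 4 f; with f'^3 = (1 + f^3)^2 and f' f'' = 2
    f^2 (1 + f^3), the chain rule for (q o f)''' involves f alone. Differentiating the approximate
    equation twice costs two orders. *)
Lemma dixonT_comp (R : comNzRingType) N (f g q : {poly R}) :
  small R N.+2 (f^`() - g ^+ 2) -> small R N.+2 (g^`() - f ^+ 2) ->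
  small R N.+2 (g ^+ 3 - 1 - f ^+ 3) ->
  small R N ((q \Po f)^`()^`()^`() - (dixonT R q \Po f)).
Proof.
move=> h1 h2 h3.
have h4 : small R N.+1 (f^`()^`() - 2 * g * f ^+ 2).
  rewrite [X in small _ _ X](_ : _ = (f^`() - g ^+ 2)^`() + 2 * g * (g^`() - f ^+ 2)); last first.
    by rewrite derivB deriv_exp /=; ring.
  apply: smallD; first exact: small_deriv.
  by apply: smallMl; apply: (smallW _ _ _ _ _ h2); lia.
have h5 : small R N (f^`()^`()^`() - 6 * f ^+ 4 - 4 * f).
  rewrite [X in small _ _ X](_ : _ = (f^`()^`() - 2 * g * f ^+ 2)^`()
    + 2 * f ^+ 2 * (g^`() - f ^+ 2) + 4 * g * f * (f^`() - g ^+ 2)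
    + 4 * f * (g ^+ 3 - 1 - f ^+ 3)); last first.
    rewrite derivB !derivM -[2]polyC_natr derivC polyC_natr; ring.
  do ?apply: smallD; first exact: small_deriv.
  - by apply: smallMl; apply: (smallW _ _ _ _ _ h2); lia.
  - by apply: smallMl; apply: (smallW _ _ _ _ _ h1); lia.
  - by apply: smallMl; apply: (smallW _ _ _ _ _ h3); lia.
have {}h1 := smallW _ _ _ _ (leqW (leqnSn N)) h1.
have {}h3 := smallW _ _ _ _ (leqW (leqnSn N)) h3.
have {}h4 := smallW _ _ _ _ (leqnSn N) h4.
rewrite !(deriv_comp, derivM, derivD) /dixonT !(comp_polyD, comp_polyM) comp_polyX.
have -> : 1 \Po f = 1 by rewrite -polyC1 comp_polyC.
move: (q^`() \Po f) (q^`()^`() \Po f) (q^`()^`()^`() \Po f) => a1 a2 a3.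
rewrite [X in small _ _ X](_ : _ =
   (a3 * (f^`() ^+ 2 + f^`() * g ^+ 2 + g ^+ 4) + 3 * a2 * f^`()^`()) * (f^`() - g ^+ 2)
   + (a3 * (g ^+ 3 + 1 + f ^+ 3) + 6 * a2 * f ^+ 2) * (g ^+ 3 - 1 - f ^+ 3)
   + (3 * a2 * g ^+ 2) * (f^`()^`() - 2 * g * f ^+ 2)
   + a1 * (f^`()^`()^`() - 6 * f ^+ 4 - 4 * f)); last ring.
by do ?apply: smallD; apply: smallMl.
Qed.

(** Each round of three derivatives costs three orders of precision; the extra 2 is the loss inside
    [dixonT_comp]. *)
Lemma dixonT_iter (R : comNzRingType) L K n (f g q : {poly R}) :
  small R L (f^`() - g ^+ 2) -> small R L (g^`() - f ^+ 2) ->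
  small R L (g ^+ 3 - 1 - f ^+ 3) -> (K + 3 * n + 2 <= L)%N ->
  small R K ((q \Po f)^`(3 * n) - (iter n (dixonT R) q \Po f)).
Proof.
move=> h1 h2 h3; elim: n K => [|n IH] K KL.
  by exists 0; rewrite mul0r muln0 subrr.
rewrite mulnS !addSn add0n !derivnS iterS.
set A := _^`(3 * n); set B := iter n _ q.
rewrite [X in small _ _ X](_ : _ = (A - (B \Po f))^`()^`()^`()
  + ((B \Po f)^`()^`()^`() - (dixonT R B \Po f))); last by rewrite !derivB; ring.
apply: smallD.
  by do 3 apply: small_deriv; apply: (IH K.+3); lia.
have KL' : (K.+2 <= L)%N by lia.
by apply: (dixonT_comp _ _ _ g);
  [exact: (smallW _ _ _ _ _ h1) | exact: (smallW _ _ _ _ _ h2) | exact: (smallW _ _ _ _ _ h3)].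
Qed.

(** Both sides are the coefficient of x in the derivative of order 3n of f: on the left because u_n
    is the coefficient of x^(3n+1) in f, on the right because f(0) = 0 and f'(0) = 1, so that
    composing with f preserves the linear coefficient. *)
Lemma dixon_iter_coef (R : realType) N n (u : {poly R}) : (3 * n + 4 <= N)%N ->
  small R N.+1 (dixon_poly R N.+1 * u - 1) ->
  (3 * n + 1)`!%:R * u`_n = (iter n (dixonT R) 'X)`_1.
Proof.
move=> nN hu; have N1 : (1 <= N)%N by lia.
have [h1 h2 h3] := dixon_pair R N u N1 hu.
have KL : (2 + 3 * n + 2 <= N)%N by lia.
have := dixonT_iter _ _ _ n _ _ 'X h1 h2 h3 KL.
move/small_coefP/(_ 1%N isT)/eqP; rewrite coefB subr_eq0 comp_polyX => /eqP.
rewrite coef_derivn coefXM addn1 /= coef_comp_poly_Xn // dvdn_mulr // mulKn //.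
have u0 : u`_0 = 1.
  move/small_coefP: hu => /(_ 0%N isT)/eqP; rewrite coefB subr_eq0 coefM big_ord1 coef1.
  by rewrite subn0 coef_poly /= dixon_coef0 mul1r => /eqP.
have coef1D (p : {poly R}) : p`_1 = p^`().[0] by rewrite horner_coef0 coef_deriv.
rewrite [in RHS]coef1D deriv_comp hornerM horner_comp derivM derivX.
rewrite !hornerE /= horner_comp !hornerE /= expr0n /= !horner_coef0 u0 !coef_deriv.
rewrite mulr1n mulr1 => <-; rewrite mulr_natl; congr (_ *+ _).
by rewrite -(ffact_fact (leqnSn (3 * n))) subSnn muln1.
Qed.

(* Normalised so that [x^2 Q_k] has the same three coefficients as [dixonT X^(3k+1)]. *)
Definition qpoly (R : realType) (k : nat) : {poly R} :=
  Num.sqrt (3 * k + 1)%:R *: opoly (bstar R) (2 * k).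

(** * Matching the orthogonal polynomials with powers of f *)

Lemma bstar_neq0 (R : realType) k : bstar R k != 0.
Proof.
have sq (m : nat) : Num.sqrt (3 * m + 1)%:R != 0 :> R.
  by rewrite gt_eqF // sqrtr_gt0 ltr0n addn1.
rewrite /bstar; case: ifP => [ko|_]; rewrite mulf_neq0 // pnatr_eq0 ?addnS //.
by case: k ko.
Qed.

(** The recurrence of the P_n applied twice; the products of consecutive b's leave exactly the
    square roots that the normalisation cancels, and the middle coefficient is m ((m + 1)^2 + (m -
    1)^2). For k = 0 one has m = 1, so the last coefficient is 0 and the truncated predecessor
    [k.-1] does no harm. *)
Lemma qpoly_rec (R : realType) k (m := (3 * k + 1)%:R : R) :
  'X^2 * qpoly R k = (m * (m + 1) * (m + 2)) *: qpoly R k.+1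
    + (2 * m * (m ^+ 2 + 1)) *: qpoly R k
    + (m * (m - 1) * (m - 2)) *: qpoly R k.-1.
Proof.
have sq (j : nat) : Num.sqrt (3 * j + 1)%:R ^+ 2 = (3 * j + 1)%:R :> R.
  by rewrite sqr_sqrtr // ler0n.
have X2 (p : {poly R}) : 'X^2 * p = 'X * ('X * p) by rewrite mulrA.
have be j : bstar R (2 * j) = Num.sqrt (3 * j + 1)%:R * (3 * j + 2)%:R := bstar_even R j.
have bo j : bstar R (2 * j).+1 = (3 * j.+1)%:R * Num.sqrt (3 * j.+1 + 1)%:R.
  by rewrite -bstar_odd //; congr bstar; lia.
have rodd j : 'X * opoly (bstar R) (2 * j).+1 =
    bstar R (2 * j).+1 *: opoly (bstar R) (2 * j.+1) + bstar R (2 * j) *: opoly (bstar R) (2 * j).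
  by rewrite opoly_rec ?bstar_neq0 // mulnS.
have XX0 : 'X * ('X * opoly (bstar R) (2 * 0)) =
    bstar R 0 *: (bstar R 1 *: opoly (bstar R) (2 * 1) + bstar R 0 *: opoly (bstar R) (2 * 0)).
  by rewrite (opoly_rec0 (bstar_neq0 R 0)) -(scalerAr _ 'X (opoly _ 1)) (rodd 0%N).
have XX j : 'X * ('X * opoly (bstar R) (2 * j.+1)) =
    bstar R (2 * j.+1) *: (bstar R (2 * j.+1).+1 *: opoly (bstar R) (2 * j.+2)
       + bstar R (2 * j.+1) *: opoly (bstar R) (2 * j.+1))
    + bstar R (2 * j).+1 *: (bstar R (2 * j).+1 *: opoly (bstar R) (2 * j.+1)
       + bstar R (2 * j) *: opoly (bstar R) (2 * j)).
  have -> : 'X * opoly (bstar R) (2 * j.+1) = bstar R (2 * j.+1) *: opoly (bstar R) (2 * j.+1).+1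
      + bstar R (2 * j).+1 *: opoly (bstar R) (2 * j).+1.
    by have := opoly_rec (bstar_neq0 R (2 * j).+2); rewrite mulnS.
  rewrite mulrDr -(scalerAr _ 'X (opoly _ (2 * j.+1).+1)) -(scalerAr _ 'X (opoly _ (2 * j).+1)).
  by rewrite (rodd j.+1) (rodd j).
rewrite /qpoly /m {m} X2 -(scalerAr _ 'X (opoly _ _)) -(scalerAr _ 'X ('X * opoly _ _)).
case: k => [|k].
  have b1 : bstar R 1 = (3 * 1)%:R * Num.sqrt (3 * 1 + 1)%:R := bo 0%N.
  have b0 : bstar R 0 = Num.sqrt (3 * 0 + 1)%:R * (3 * 0 + 2)%:R := be 0%N.
  rewrite XX0 b1 b0 !scalerDr !scalerA -addrA; congr (_ *: _ + _).
    rewrite !muln0 muln1 !add0n sqrtr1; move: (Num.sqrt _) => r; ring.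
  rewrite -scalerDl; congr (_ *: _); rewrite !muln0 !add0n sqrtr1; ring.
rewrite XX !bo !be !scalerDr !scalerA -!addrA.
have := sq k; have := sq k.+1; have := sq k.+2.
have -> : (3 * k.+2 + 1)%:R = 3 * k%:R + 7 :> R by rewrite natrD natrM -[k.+2]addn2 natrD; ring.
have -> : (3 * k.+1 + 1)%:R = 3 * k%:R + 4 :> R by rewrite natrD natrM -[k.+1]addn1 natrD; ring.
have -> : (3 * k.+1 + 2)%:R = 3 * k%:R + 5 :> R by rewrite natrD natrM -[k.+1]addn1 natrD; ring.
have -> : (3 * k.+1)%:R = 3 * k%:R + 3 :> R by rewrite natrM -[k.+1]addn1 natrD; ring.
have -> : (3 * k.+2)%:R = 3 * k%:R + 6 :> R by rewrite natrM -[k.+2]addn2 natrD; ring.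
have -> : (3 * k + 1)%:R = 3 * k%:R + 1 :> R by rewrite natrD natrM.
have -> : (3 * k + 2)%:R = 3 * k%:R + 2 :> R by rewrite natrD natrM.
move: k%:R => t.
move: (Num.sqrt (3 * t + 7)) (Num.sqrt (3 * t + 4)) (Num.sqrt (3 * t + 1)) => r2 r1 r0 h2 h1 h0.
congr (_ *: _ + _).
  rewrite [RHS](_ : _ = (3 * t + 4) * ((3 * t + 5) * (3 * t + 6) * r2)); last by ring.
  by rewrite -h1; ring.
rewrite !addrA -scalerDl; congr (_ *: _ + _ *: _).
  rewrite [LHS](_ : _ = r1 * ((3 * t + 5) ^+ 2 * r1 ^+ 2 + (3 * t + 3) ^+ 2 * r1 ^+ 2));
    last by ring.
  rewrite h1; ring.
rewrite [LHS](_ : _ = r1 ^+ 2 * ((3 * t + 3) * (3 * t + 2) * r0)); last by ring.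
by rewrite h1 /=; ring.
Qed.

(* [moment_rel q h]: h is obtained from q by replacing X^(3k+1) with [qpoly k]. *)
Inductive moment_rel (R : realType) : {poly R} -> {poly R} -> Prop :=
| MomentRel0 : moment_rel R 0 0
| MomentRelD c k q h : moment_rel R q h ->
    moment_rel R (c *: 'X^(3 * k + 1) + q) (c *: qpoly R k + h).

Lemma dixonTD (R : comNzRingType) (p q : {poly R}) : dixonT R (p + q) = dixonT R p + dixonT R q.
Proof. rewrite /dixonT !derivD; ring. Qed.

Lemma dixonTZ (R : comNzRingType) c (q : {poly R}) : dixonT R (c *: q) = c *: dixonT R q.
Proof. rewrite /dixonT !derivZ -!mul_polyC; ring. Qed.

(** The coefficients agree with those of [qpoly_rec], including the one that vanishes at k = 0; this
    coincidence is what singles out the given b's. *)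
Lemma dixonTXn (R : realType) k (m := (3 * k + 1)%:R : R) :
  dixonT R 'X^(3 * k + 1) = (m * (m + 1) * (m + 2)) *: 'X^(3 * k.+1 + 1)
    + (2 * m * (m ^+ 2 + 1)) *: 'X^(3 * k + 1)
    + (m * (m - 1) * (m - 2)) *: 'X^(3 * k.-1 + 1).
Proof.
rewrite /m {m} -!mul_polyC !(polyCM, polyCD, polyCN) !polyC_natr /dixonT.
case: k => [|k]; first by rewrite !muln0 !muln1 !add0n expr1 derivX !derivC; ring.
rewrite (_ : (3 * k.+2 + 1)%N = (3 * k).+1.+3.+3); last by lia.
rewrite (_ : (3 * k.+1 + 1)%N = (3 * k).+1.+3); last by lia.
rewrite (_ : (3 * k.+1.-1 + 1)%N = (3 * k).+1); last by rewrite addn1.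
move: (3 * k).+1 => n; rewrite derivXn derivMn /= derivXn /= !derivMn derivXn /=.
have mn (p : {poly R}) j : p *+ j = p * j%:R by rewrite mulr_natr.
rewrite !polyC1 (mn 'X^n) (mn ('X^n * _)) (mn ('X^n * _ * _)).
rewrite (mn 'X^(n.+1)) (mn ('X^(n.+1) * _)) (mn 'X^(n.+2)).
have := @natr1 {poly R} n.+2; have := @natr1 {poly R} n.+1.
move: (n.+1%:R) (n.+2%:R) (n.+3%:R) => M M1 M2 e1 e2; rewrite -e2 -e1.
rewrite (_ : 'X^(n.+2.+4) = 'X^6 * 'X^n); last by rewrite -exprD.
rewrite (_ : 'X^(n.+3) = 'X^3 * 'X^n); last by rewrite -exprD.
rewrite (_ : 'X^(n.+2) = 'X^2 * 'X^n); last by rewrite -exprD.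
rewrite (_ : 'X^(n.+1) = 'X * 'X^n); last by rewrite -exprS.
by move: 'X^n => Y; ring.
Qed.

Lemma dixonT_moment_rel (R : realType) (q h : {poly R}) :
  moment_rel R q h -> moment_rel R (dixonT R q) ('X^2 * h).
Proof.
elim=> [|c k {}q {}h qh IH].
  rewrite /dixonT !linear0 !mul0r !mulr0 !mul0r !addr0; exact: MomentRel0.
rewrite [X in moment_rel _ _ X]mulrDr -(scalerAr c) qpoly_rec dixonTD dixonTZ dixonTXn.
rewrite !scalerDr !(scalerA c) -!addrA.
by do 3 apply: MomentRelD.
Qed.

Lemma integrable_poly (R : realType) (mu : {measure set (measurableTypeR R) -> \bar R})
    (p : {poly R}) : has_all_moments mu -> mu.-integrable setT (fun x : R => (p.[x])%:E).
Proof.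
move=> hmu; under [X in _.-integrable _ X]eq_fun do rewrite horner_coef -sumEFin.
apply: integrable_sum => // i _.
under [X in _.-integrable _ X]eq_fun do rewrite EFinM.
by apply: integrableZl.
Qed.

(** Integrating is pairing with P_0 = 1, so orthonormality keeps only the coefficient of Q_0 = 1 in
    [h]; the corresponding coefficient in [q] is that of X. *)
Lemma moment_rel_integral (R : realType) (mu : {measure set (measurableTypeR R) -> \bar R})
    (q h : {poly R}) : has_all_moments mu -> orthonormal_polys mu (opoly (bstar R)) ->
  moment_rel R q h -> (\int[mu]_(x in setT) h.[x])%R = q`_1.
Proof.
move=> hmu hP; elim=> [|c k {}q {}h _ IH].
  under eq_Rintegral do rewrite horner0; by rewrite /Rintegral integral0 coef0.
have intP p := integrable_poly R mu p hmu.
have -> : (\int[mu]_(x in setT) (c *: qpoly R k + h).[x])%R =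
    c * Num.sqrt (3 * k + 1)%:R *
    (\int[mu]_(x in setT) ((opoly (bstar R) (2 * k)).[x] * (opoly (bstar R) 0).[x]))%R + q`_1.
  under [in RHS]eq_Rintegral do rewrite -hornerM.
  rewrite -IH -RintegralZl //; last exact: intP.
  under [X in _ = X + _]eq_Rintegral do rewrite -hornerZ.
  rewrite -RintegralD //; [|exact: intP..].
  by apply: eq_Rintegral => x _; rewrite opoly0 /qpoly hornerD !hornerZ mulr1 mulrA.
rewrite hP coefD coefZ coefXn; case: k => [|k]; last by rewrite !mulr0 !add0r addn1 mulr0 add0r.
by rewrite muln0 add0n sqrtr1 eqxx !mulr1.
Qed.

(** x^(2n) arises from Q_0 = 1 by n multiplications with x^2, and ['X] corresponds to Q_0. The
    right-hand side no longer mentions the measure, which need not be known. *)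
Lemma symmetric_moments_dixonT (R : realType) (s : nat -> R) n :
  symmetric_moments (bstar R) s -> s (2 * n)%N = (iter n (dixonT R) 'X)`_1.
Proof.
move=> [mu [_ hmu hP hs]]; rewrite hs.
rewrite -(moment_rel_integral R mu (iter n (dixonT R) 'X) 'X^(2 * n)) //.
  by apply: eq_Rintegral => x _; rewrite hornerXn.
elim: n => [|n IH]; last first.
  by rewrite iterS mulnS exprD; exact: dixonT_moment_rel.
have := MomentRelD R 1 0 0 0 (MomentRel0 R).
by rewrite !addr0 !scale1r /qpoly muln0 add0n sqrtr1 scale1r opoly0.
Qed.

Definition dixon_moment (R : realType) (s : nat -> R) (n : nat) : R :=
  s (2 * n)%N / (3 * n + 1)`!%:R.

(** The numbers s_{2n} / (3n+1)! are the coefficients of 1/E, read off from an inverse modulo a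
    power high enough for index n. *)
Lemma dixon_moment_conv (R : realType) (s : nat -> R) n :
  symmetric_moments (bstar R) s ->
  \sum_(i < n.+1) dixon_coef R i * dixon_moment R s (n - i) = (n == 0%N)%:R.
Proof.
move=> hs; pose N := (3 * n + 4)%N.
have [|u hu] := small_inverse R N.+1 (dixon_poly R N.+1).
  by rewrite coef_poly dixon_coef0.
have cu i : (i <= n)%N -> dixon_moment R s i = u`_i.
  move=> ni; rewrite /dixon_moment (symmetric_moments_dixonT _ _ _ hs).
  rewrite -(dixon_iter_coef R N i u) //; last by rewrite /N; lia.
  by rewrite mulrC mulKf // pnatr_eq0 -lt0n fact_gt0.
have nN : (n < N.+1)%N by rewrite /N; lia.
move/small_coefP: hu => /(_ n nN)/eqP; rewrite coefB subr_eq0 coef1 => /eqP <-.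
rewrite coefM; apply: eq_bigr => i _; rewrite cu ?leq_subr // coef_poly.
by rewrite (leq_ltn_trans (leq_ord i) nN).
Qed.

(** * Geometric coefficient bounds and evaluation *)

(** Absorbs a factor n + 1 into the ratio, so every Cauchy product or derivative worsens a geometric
    bound by 3/2. Starting from 1/18, at most two such steps occur, giving 1/12 and 1/8; hence the
    radius 7 used below, under 8 and beyond the point 6. *)
Lemma leq_succ_exp (R : realFieldType) n : n.+1%:R <= 2 * (3 / 2) ^+ n :> R.
Proof.
elim: n => [|[|n] IH]; first by rewrite expr0; lra.
  by rewrite expr1; lra.
rewrite exprS; move: IH; have : 1 <= n.+1%:R :> R by rewrite ler1n.
by rewrite -(natr1 n.+2) -(natr1 n.+1); move: (n.+1%:R) (_ ^+ _) => a b; lra.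
Qed.

Definition geo_bounded (R : realFieldType) (r B : R) (q : {poly R}) : Prop :=
  forall n, `|q`_n| <= B * r ^+ n.

Section GeoBounded.
Variable R : realFieldType.
Implicit Types (r B : R) (p q : {poly R}).

Lemma geo_boundedD r B1 B2 p q :
  geo_bounded R r B1 p -> geo_bounded R r B2 q -> geo_bounded R r (B1 + B2) (p + q).
Proof.
by move=> hp hq n; rewrite coefD mulrDl (le_trans (ler_normD _ _)) // lerD.
Qed.

Lemma geo_boundedZ r B c q : geo_bounded R r B q -> geo_bounded R r (`|c| * B) (c *: q).
Proof. by move=> hq n; rewrite coefZ normrM -mulrA ler_wpM2l. Qed.

Lemma geo_boundedN r B q : geo_bounded R r B q -> geo_bounded R r B (- q).
Proof. by move=> hq n; rewrite coefN normrN. Qed.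

Lemma geo_boundedW r r' B q : 0 <= r <= r' -> 0 <= B ->
  geo_bounded R r B q -> geo_bounded R r' B q.
Proof.
move=> /andP[r0 rr'] B0 hq n; apply: le_trans (hq n) _; apply: ler_wpM2l => //.
by apply: lerXn2r; rewrite ?nnegrE // (le_trans r0).
Qed.

Lemma geo_boundedM r B1 B2 p q : 0 <= r -> 0 <= B1 -> 0 <= B2 ->
  geo_bounded R r B1 p -> geo_bounded R r B2 q ->
  geo_bounded R (3 / 2 * r) (2 * B1 * B2) (p * q).
Proof.
move=> r0 B10 B20 hp hq n; rewrite coefM; apply: le_trans (ler_norm_sum _ _ _) _.
apply: (@le_trans _ _ (\sum_(i < n.+1) B1 * B2 * r ^+ n)).
  apply: ler_sum => i _; rewrite normrM.
  apply: le_trans (ler_pM _ _ (hp i) (hq (n - i)%N)) _ => //.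
  by rewrite mulrACA -exprD subnKC // leq_ord.
rewrite sumr_const card_ord -[_ *+ n.+1]mulr_natl exprMn.
rewrite [leRHS](_ : _ = 2 * (3 / 2) ^+ n * (B1 * B2 * r ^+ n)); last first.
  by move: ((3 / 2) ^+ n) (r ^+ n) => u v; ring.
by apply: ler_wpM2r (leq_succ_exp _ _); rewrite !mulr_ge0 // exprn_ge0.
Qed.

Lemma geo_bounded_Xderiv r B q : 0 <= r -> 0 <= B -> geo_bounded R r B q ->
  geo_bounded R (3 / 2 * r) (2 * B) ('X * q^`()).
Proof.
move=> r0 B0 hq n; rewrite coefXM; case: eqP => [_|/eqP n0].
  by rewrite normr0 !mulr_ge0 ?exprn_ge0 ?mulr_ge0.
rewrite coef_deriv prednK ?lt0n // -[_ *+ n]mulr_natl normrM normr_nat exprMn mulrACA.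
apply: ler_pM => //; apply: le_trans (leq_succ_exp _ _).
by rewrite ler_nat.
Qed.

Lemma geo_sum_le (rho : R) n : 0 <= rho < 1 -> \sum_(i < n) rho ^+ i <= (1 - rho)^-1.
Proof.
move=> /andP[r0 r1]; rewrite -[leRHS]mul1r ler_pdivlMr ?subr_gt0 // mulrC.
by rewrite -[leLHS]opprK -mulNr opprB -subrX1 opprB gerBl exprn_ge0.
Qed.

(** Dividing by ['X^N] shifts the coefficients and leaves the bound B r^N r^i; summing the geometric
    series gives the factor. *)
Lemma geo_bounded_horner r B q N (y : R) : 0 <= r -> 0 <= B -> r * `|y| < 1 ->
  geo_bounded R r B q -> small R N q ->
  `|q.[y]| <= B / (1 - r * `|y|) * (r * `|y|) ^+ N.
Proof.
move=> r0 B0 ry hq [t qt]; have ht i : `|t`_i| <= B * r ^+ N * r ^+ i.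
  have := hq (N + i)%N; rewrite qt coefMXn ltnNge leq_addr /= addKn.
  by rewrite exprD mulrA.
rewrite qt hornerM hornerXn normrM normrX exprMn mulrA; apply: ler_wpM2r.
  exact: exprn_ge0.
rewrite horner_coef; apply: le_trans (ler_norm_sum _ _ _) _.
apply: (@le_trans _ _ (B * r ^+ N * \sum_(i < size t) (r * `|y|) ^+ i)).
  rewrite mulr_sumr; apply: ler_sum => i _; rewrite normrM normrX exprMn mulrA.
  by apply: ler_wpM2r; rewrite ?exprn_ge0.
rewrite [leRHS]mulrAC; apply: ler_wpM2l; first by rewrite mulr_ge0 // exprn_ge0.
by apply: geo_sum_le; rewrite ry mulr_ge0.
Qed.
End GeoBounded.

Lemma cvg0_le_norm (R : realFieldType) (u v : nat -> R) :
  (forall n, `|u n| <= v n) -> v @ \oo --> (0 : R) -> u @ \oo --> (0 : R).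
Proof.
move=> uv v0; apply: (@squeeze_cvgr _ _ _ _ (fun n => - v n) v) => //.
  by apply: nearW => n; rewrite -ler_norml.
by rewrite -oppr0; exact: cvgN.
Qed.

(** The bridge from formal to real identities: the defect of a truncated identity is 0 modulo ['X^N]
    and has coefficients bounded uniformly in N, so its value tends to 0. The offset 2 accommodates
    [dixon_poly_cube], stated for N >= 2. *)
Lemma geo_bounded_cvg0 (R : realType) (r B y : R) (q : nat -> {poly R}) :
  0 <= r -> 0 <= B -> r * `|y| < 1 ->
  (forall N, geo_bounded R r B (q N.+2)) -> (forall N, small R N.+2 (q N.+2)) ->
  (fun N => (q N).[y]) @ \oo --> (0 : R).
Proof.
move=> r0 B0 ry hB hs; rewrite -(cvg_shiftn 2) /=.
apply: (cvg0_le_norm _ _ (geometric (B / (1 - r * `|y|) * (r * `|y|) ^+ 2) (r * `|y|))).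
  move=> N; rewrite /= addn2.
  apply: le_trans (geo_bounded_horner _ _ _ _ _ _ r0 B0 ry (hB N) (hs N)) _.
  by rewrite -[leRHS]mulrA -exprD.
by apply: cvg_geometric; rewrite ger0_norm // mulr_ge0.
Qed.

(** * The real function E *)

Definition dixonE (R : realType) (y : R) : R := limn (pseries (dixon_coef R) y).

Definition dixonE' (R : realType) (y : R) : R :=
  limn (pseries (pseries_diffs (dixon_coef R)) y).

Lemma dixon_coef_le (R : realType) n : `|dixon_coef R n| <= 3 * (1 / 18) ^+ n.
Proof.
rewrite div1r exprVn; case: n => [|n]; last exact: dixon_coef_bound.
by rewrite dixon_coef0 normr1 expr0 invr1; lra.
Qed.

Lemma pseries_diffs_le (R : realType) (c : nat -> R) (B r : R) : 0 <= r -> 0 <= B ->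
  (forall n, `|c n| <= B * r ^+ n) ->
  forall n, `|pseries_diffs c n| <= 2 * B * r * (3 / 2 * r) ^+ n.
Proof.
move=> r0 B0 hc n; rewrite /pseries_diffs normrM normr_nat exprMn.
rewrite [leRHS](_ : _ = (2 * (3 / 2) ^+ n) * (B * r ^+ n.+1)); last first.
  by rewrite exprS; move: ((3 / 2) ^+ n) (r ^+ n) => u v; ring.
by apply: ler_pM => //; exact: leq_succ_exp.
Qed.

Lemma is_cvg_pseries_le (R : realType) (c : nat -> R) (B r K : R) : 0 <= r -> 0 <= K ->
  (forall n, `|c n| <= B * r ^+ n) -> r * K < 1 -> cvgn (pseries c K).
Proof.
move=> r0 K0 hc rK; apply: normed_cvg.
have B0 : 0 <= B by have := hc 0%N; rewrite expr0 mulr1; apply: le_trans.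
have rK0 : 0 <= r * K by rewrite mulr_ge0.
apply: (@series_le_cvg _ _ (geometric B (r * K))).
- by move=> n; exact: normr_ge0.
- by move=> n; rewrite geometric_ge0.
- move=> n; rewrite /= normrM normrX (ger0_norm K0) exprMn mulrA; apply: ler_wpM2r => //.
  exact: exprn_ge0.
- by apply: is_cvg_geometric_series; rewrite ger0_norm.
Qed.

Lemma dixon_poly_hornerE (R : realType) N (y : R) :
  (dixon_poly R N).[y] = pseries (dixon_coef R) y N.
Proof. by rewrite horner_poly /pseries /series /= big_mkord. Qed.

Lemma dixon_poly_derivE (R : realType) N (y : R) :
  (dixon_poly R N.+1)^`().[y] = pseries (pseries_diffs (dixon_coef R)) y N.
Proof.
rewrite (@horner_coef_wide _ N); last first.
  by apply/leq_sizeP => j Nj; rewrite coef_deriv coef_poly ltnS ltnNge Nj mul0rn.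
rewrite /pseries /series /= big_mkord; apply: eq_bigr => i _.
by rewrite coef_deriv coef_poly ltnS ltn_ord /pseries_diffs mulr_natl.
Qed.

Lemma dixon_coef2 (R : realType) : dixon_coef R 2 = - (1 / 252).
Proof. by rewrite dixon_coef_rec // big_nat1 dixon_coef1 natrM; field. Qed.

Lemma dixon_coef3 (R : realType) : dixon_coef R 3 = 1 / 4536.
Proof.
rewrite dixon_coef_rec // big_nat_recr // big_nat1 /= dixon_coef1 dixon_coef2 natrM.
by field.
Qed.

Section DixonReal.
Variable R : realType.

Let c := dixon_coef R.

Let c7 : cvgn (pseries c 7).
Proof. apply: (is_cvg_pseries_le _ _ 3 (1 / 18)); try lra. exact: dixon_coef_le. Qed.

Let c'_le n : `|pseries_diffs c n| <= 1 / 3 * (1 / 12) ^+ n.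
Proof.
have h0 : 0 <= 1 / 18 :> R by lra.
have h3 : 0 <= 3 :> R by lra.
have := pseries_diffs_le _ _ _ _ h0 h3 (dixon_coef_le R) n.
have -> : 3 / 2 * (1 / 18) = 1 / 12 :> R by lra.
by have -> : 2 * 3 * (1 / 18) = 1 / 3 :> R by lra.
Qed.

Let c'7 : cvgn (pseries (pseries_diffs c) 7).
Proof. apply: (is_cvg_pseries_le _ _ (1 / 3) (1 / 12)); try lra. exact: c'_le. Qed.

Let c''7 : cvgn (pseries (pseries_diffs (pseries_diffs c)) 7).
Proof.
have h0 : 0 <= 1 / 12 :> R by lra.
have h3 : 0 <= 1 / 3 :> R by lra.
apply: (is_cvg_pseries_le _ _ _ (3 / 2 * (1 / 12))); try lra.
exact: (pseries_diffs_le _ _ _ _ h0 h3 c'_le).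
Qed.

Lemma is_derive_dixonE (y : R) : `|y| < 7 -> is_derive y 1 (dixonE R) (dixonE' R y).
Proof.
move=> y7; apply: (pseries_snd_diffs c7 c'7 c''7).
by rewrite (ger0_norm (_ : 0 <= 7)) //; lra.
Qed.

Lemma cvg_dixonE (y : R) : `|y| < 7 -> (fun N => (dixon_poly R N).[y]) @ \oo --> dixonE R y.
Proof.
move=> y7; under eq_fun do rewrite dixon_poly_hornerE.
apply: (is_cvg_pseries_inside c7).
by rewrite (ger0_norm (_ : 0 <= 7)) //; lra.
Qed.

Lemma cvg_dixonE' (y : R) : `|y| < 7 ->
  (fun N => (dixon_poly R N)^`().[y]) @ \oo --> dixonE' R y.
Proof.
move=> y7; rewrite -(cvg_shiftS _ _); under eq_fun do rewrite /= dixon_poly_derivE.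
apply: (is_cvg_pseries_inside c'7).
by rewrite (ger0_norm (_ : 0 <= 7)) //; lra.
Qed.

Lemma cvg_dixonEN (y : R) : `|y| < 7 ->
  (fun N => (dixon_polyN R N).[y]) @ \oo --> dixonE R (- y).
Proof.
move=> y7; under eq_fun do rewrite -dixon_poly_compN horner_comp hornerN hornerX.
by apply: cvg_dixonE; rewrite normrN.
Qed.

Let geoP N : geo_bounded R (1 / 18) 3 (dixon_poly R N).
Proof.
move=> n; rewrite coef_poly; case: ifP => _; first exact: dixon_coef_le.
by rewrite normr0 mulr_ge0 // exprn_ge0.
Qed.

Let geoN N : geo_bounded R (1 / 18) 3 (dixon_polyN R N).
Proof.
move=> n; rewrite coef_poly; case: ifP => _.
  by rewrite normrM normrX normrN1 expr1n [leLHS]mul1r; exact: dixon_coef_le.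
by rewrite normr0 mulr_ge0 // exprn_ge0.
Qed.

Lemma dixonE_ode (y : R) : `|y| < 7 ->
  3 * y * dixonE' R y = dixonE R y - dixonE R (- y) ^+ 2.
Proof.
move=> y7; apply/eqP; rewrite -subr_eq0 opprB; apply/eqP.
pose q N : {poly R} := 3 * 'X * (dixon_poly R N)^`() - dixon_poly R N + dixon_polyN R N ^+ 2.
have q0 : (fun N => (q N).[y]) @ \oo --> (0 : R).
  apply: (geo_bounded_cvg0 _ (1 / 12) (`|3| * (2 * 3) + 3 + 2 * 3 * 3)).
  - lra.
  - by rewrite ger0_norm //; lra.
  - by have := normr_ge0 y; lra.
  - move=> N; rewrite /q -polyC_natr mul_polyC -(scalerAl _ 'X).
    have r12 : 3 / 2 * (1 / 18) = 1 / 12 :> R by lra.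
    apply: geo_boundedD; first apply: geo_boundedD.
    + by apply: geo_boundedZ; rewrite -r12; apply: geo_bounded_Xderiv => //; lra.
    + by apply: geo_boundedN; apply: geo_boundedW (geoP _); lra.
    + by rewrite -r12; apply: geo_boundedM => //; lra.
  - by move=> N; exact: dixon_poly_ode.
have q1 : (fun N => (q N).[y]) @ \oo -->
    3 * y * dixonE' R y - dixonE R y + dixonE R (- y) * dixonE R (- y).
  rewrite (_ : (fun N => (q N).[y]) = (fun N => 3 * y * (dixon_poly R N)^`().[y]
    - (dixon_poly R N).[y] + (dixon_polyN R N).[y] * (dixon_polyN R N).[y])); last first.
    by apply/funext => N; rewrite /q -polyC_natr !hornerE.
  apply: cvgD; last by apply: cvgM; exact: cvg_dixonEN.
  apply: cvgB; last exact: cvg_dixonE.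
  by apply: cvgM; [exact: cvg_cst | exact: cvg_dixonE'].
by rewrite addrA addrAC expr2 (cvg_unique _ q1 q0).
Qed.

Lemma dixonE_cube (y : R) : `|y| < 7 -> dixonE R (- y) ^+ 3 - dixonE R y ^+ 3 = y.
Proof.
move=> y7; apply/eqP; rewrite -subr_eq0; apply/eqP.
pose q N : {poly R} := dixon_polyN R N ^+ 3 - dixon_poly R N ^+ 3 - 'X.
have q0 : (fun N => (q N).[y]) @ \oo --> (0 : R).
  have r12 : 3 / 2 * (1 / 18) = 1 / 12 :> R by lra.
  have r8 : 3 / 2 * (1 / 12) = 1 / 8 :> R by lra.
  have cb (p : {poly R}) : geo_bounded R (1 / 18) 3 p ->
      geo_bounded R (1 / 8) (2 * 3 * (2 * 3 * 3)) (p ^+ 3).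
    move=> hp; rewrite -r8; apply: geo_boundedM; try lra.
      by apply: geo_boundedW hp; lra.
    by rewrite -r12; apply: geo_boundedM => //; lra.
  apply: (geo_bounded_cvg0 _ (1 / 8) (2 * 3 * (2 * 3 * 3) + 2 * 3 * (2 * 3 * 3) + 8)).
  - lra.
  - lra.
  - by have := normr_ge0 y; lra.
  - move=> N; apply: geo_boundedD; first apply: geo_boundedD.
    + exact: cb.
    + by apply: geo_boundedN; exact: cb.
    + apply: geo_boundedN => -[|[|n]]; rewrite coefX /= ?normr0 ?normr1.
      * by rewrite expr0; lra.
      * by rewrite expr1; lra.
      * by rewrite mulr_ge0 // exprn_ge0 //; lra.
  - by move=> N; exact: dixon_poly_cube.
have q1 : (fun N => (q N).[y]) @ \oo -->
    dixonE R (- y) ^+ 3 - dixonE R y ^+ 3 - y.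
  rewrite (_ : (fun N => (q N).[y]) = (fun N => (dixon_polyN R N).[y] ^+ 3
    - (dixon_poly R N).[y] ^+ 3 - y)); last first.
    by apply/funext => N; rewrite /q !hornerE.
  apply: cvgB; last exact: cvg_cst.
  by apply: cvgB; [have h := cvg_dixonEN _ y7 | have h := cvg_dixonE _ y7];
    exact: cvgM h (cvgM h h).
by rewrite (cvg_unique _ q1 q0).
Qed.

Lemma dixonE0 : dixonE R 0 = 1.
Proof.
have h : `|0 : R| < 7 by rewrite normr0; lra.
have h1 : (fun N => (dixon_poly R N).[0]) @ \oo --> (1 : R).
  rewrite -(cvg_shiftS _ _); under eq_fun do
    rewrite /= horner_coef0 coef_poly /= dixon_coef0.
  exact: cvg_cst.
by rewrite (cvg_unique _ (cvg_dixonE _ h) h1).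
Qed.

(** On [0, 6] the n-th term is at most 3 (6/18)^n, and these bounds add up to 9/2 * 3^-N from N
    on. *)
Lemma dixonE_tail (y : R) N : 0 <= y <= 6 ->
  `|dixonE R y - (dixon_poly R N).[y]| <= 9 / 2 * (1 / 3) ^+ N.
Proof.
move=> /andP[y0 y6].
have y7 : `|y| < 7 by rewrite ger0_norm //; lra.
(* Keeping the subtracted term makes the induction on M telescope; it is dropped after the passage
   to the limit. *)
have fin M : `|(dixon_poly R (M + N)).[y] - (dixon_poly R N).[y]| <=
    9 / 2 * ((1 / 3) ^+ N - (1 / 3) ^+ (M + N)).
  elim: M => [|M IH]; first by rewrite add0n !subrr normr0 mulr0.
  rewrite addSn !horner_poly big_ord_recr /= -!horner_poly addrAC.
  apply: le_trans (ler_normD _ _) _.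
  have -> : 9 / 2 * ((1 / 3) ^+ N - (1 / 3) ^+ (M + N).+1) =
    9 / 2 * ((1 / 3) ^+ N - (1 / 3) ^+ (M + N)) + 3 * (1 / 3) ^+ (M + N) :> R.
    by rewrite (exprS _ (M + N)); move: ((1 / 3) ^+ N) ((1 / 3) ^+ (M + N)) => u v; lra.
  apply: lerD IH _; rewrite normrM normrX (ger0_norm y0).
  apply: (@le_trans _ _ (3 * (1 / 18) ^+ (M + N) * 6 ^+ (M + N))).
    apply: ler_pM => //; first by rewrite exprn_ge0.
      exact: dixon_coef_le.
    by apply: lerXn2r; rewrite ?nnegrE.
  rewrite -mulrA -exprMn; have -> : 1 / 18 * 6 = 1 / 3 :> R by lra.
  exact: lexx.
have cv : (fun M => `|(dixon_poly R (M + N)).[y] - (dixon_poly R N).[y]|) @ \oo -->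
    `|dixonE R y - (dixon_poly R N).[y]|.
  apply: cvg_norm; apply: cvgB; last exact: cvg_cst.
  have := cvg_dixonE _ y7; by rewrite -(cvg_shiftn N).
rewrite -(cvg_lim _ cv) //; apply: limr_le; first by apply: cvgP cv.
apply: nearW => M; apply: le_trans (fin M) _; apply: ler_wpM2l; first by lra.
by rewrite gerBl exprn_ge0 //; lra.
Qed.

(** Four terms at 6 give 1 - 1 - 1/7 + 1/21 = -2/21, and the tail is at most 1/18. *)
Lemma dixonE6_lt0 : dixonE R 6 < 0.
Proof.
have h : 0 <= (6 : R) <= 6 by apply/andP; split; lra.
have := dixonE_tail 6 4 h; rewrite horner_poly !big_ord_recr big_ord0 /=.
rewrite dixon_coef0 dixon_coef1 dixon_coef2 dixon_coef3 ler_norml => /andP[_].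
lra.
Qed.
End DixonReal.

Lemma continuous_dixonE (R : realType) (y : R) : `|y| < 7 ->
  {for y, continuous (dixonE R)}.
Proof.
move=> y7; apply: differentiable_continuous; apply/derivable1_diffP.
by have [] := is_derive_dixonE R y y7.
Qed.

(** * The first zero of E and the Dixon functions *)

(** Taking the infimum of the points with E <= 0, rather than of the zeros, makes positivity before
    a immediate; continuity then excludes both signs at a. *)
Lemma dixonE_first_zero (R : realType) : exists a : R,
  [/\ 0 < a <= 6, dixonE R a = 0 & forall y, 0 <= y < a -> 0 < dixonE R y].
Proof.
pose A : set R := [set y | 0 <= y <= 6 /\ dixonE R y <= 0].
have A6 : A 6 by split; [lra | exact: ltW (dixonE6_lt0 R)].
have lbA : has_lbound A by exists 0 => y [/andP[]].
have infA : has_inf A by split=> //; exists 6.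
pose a := inf A.
have a_le y : A y -> a <= y by exact: ge_inf.
have a0 : 0 <= a by apply: lb_le_inf; [exists 6 | move=> y [/andP[]]].
have a6 : a <= 6 by exact: a_le.
have a7 : `|a| < 7 by rewrite ger0_norm //; lra.
have pos y : 0 <= y < a -> 0 < dixonE R y.
  move=> /andP[y0 ya]; rewrite ltNge; apply/negP => Ey.
  have : A y by split; lra.
  by move/a_le; lra.
have ca := continuous_dixonE R a a7.
have Ea_le : dixonE R a <= 0.
  rewrite leNgt; apply/negP => Ea.
  have [e /= e0 he] := cvgr_gt _ ca _ Ea.
  have [y Ay ye] := inf_adherent e0 infA; rewrite -/a in ye.
  have := Ay.2; rewrite leNgt => /negP; apply; apply: he.
  by rewrite /= distrC ger0_norm; have := a_le _ Ay; lra.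
have a_gt0 : 0 < a.
  by rewrite lt_neqAle a0 andbT; apply/eqP => az; move: Ea_le; rewrite -az dixonE0; lra.
exists a; split=> //; first by rewrite a_gt0.
apply/eqP; rewrite eq_le Ea_le /= leNgt; apply/negP => Ea.
have [e /= e0 he] := cvgr_lt _ ca _ Ea.
(* A point slightly left of a, kept nonnegative: E would still be negative there, against the choice
   of a. *)
pose y := Num.max 0 (a - e / 2).
have /pos : 0 <= y < a by rewrite /y le_max lexx gt_max a_gt0 /=; lra.
rewrite ltNge => /negP; apply; apply/ltW/he.
have ya : a - e / 2 <= y by rewrite /y le_max lexx orbT.
have ya' : y < a by rewrite /y gt_max a_gt0 /=; lra.
by rewrite /= ger0_norm; lra.
Qed.

Section DixonSine.
Variables (R : realType) (a : R).
Hypotheses (a06 : 0 < a <= 6) (Ea : dixonE R a = 0).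
Hypothesis E_gt0 : forall y, 0 <= y < a -> 0 < dixonE R y.

Definition dixon_sm (x : R) : R := x / dixonE R (- x ^+ 3).
Definition dixon_cm (x : R) : R := dixonE R (x ^+ 3) / dixonE R (- x ^+ 3).

Let x7 x : 0 <= x ^+ 3 <= a -> `|x ^+ 3| < 7.
Proof. by move=> /andP[h1 h2]; rewrite ger0_norm //; move: a06; lra. Qed.

(** By the cubic identity E(-y)^3 = y + E(y)^3, and E >= 0 up to its first zero. *)
Lemma dixonEN_gt0 (y : R) : 0 <= y <= a -> 0 < dixonE R (- y).
Proof.
move=> /andP[y0 ya]; have y7 : `|y| < 7 by rewrite ger0_norm //; move: a06; lra.
have Ey : 0 <= dixonE R y.
  by move: ya; rewrite le_eqVlt => /orP[/eqP->|ya]; rewrite ?Ea // ltW // E_gt0 // y0.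
have := dixonE_cube R y y7; have [->|yn0] := eqVneq y 0; first by rewrite oppr0 dixonE0; lra.
move=> cub; have : 0 < dixonE R (- y) ^+ 3.
  have : 0 <= dixonE R y ^+ 3 by exact: exprn_ge0.
  have : 0 < y by rewrite lt_neqAle eq_sym yn0.
  by move: cub; move: (dixonE R y ^+ 3) (dixonE R (- y) ^+ 3) => u v; lra.
by rewrite exprn_odd_gt0.
Qed.

Lemma dixon_sm_cm_cube x : 0 <= x ^+ 3 <= a -> dixon_sm x ^+ 3 + dixon_cm x ^+ 3 = 1.
Proof.
move=> xa; have b0 := lt0r_neq0 (dixonEN_gt0 _ xa).
rewrite /dixon_sm /dixon_cm !exprMn -mulrDl exprVn.
rewrite -{1}(dixonE_cube R _ (x7 _ xa)) subrK mulfV // expf_neq0 //.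
Qed.

Lemma is_derive_dixonE_cube x : 0 <= x ^+ 3 <= a ->
  is_derive x 1 (fun x : R => dixonE R (x ^+ 3)) (3 * x ^+ 2 * dixonE' R (x ^+ 3)).
Proof.
move=> xa; have h := is_derive_dixonE R (x ^+ 3) (x7 _ xa).
have h3 : is_derive x 1 (fun x : R => x ^+ 3) (3 * x ^+ 2).
  have := is_deriveX 3 (is_derive_id x (1 : R)); rewrite exprfctE.
  by rewrite [_ *: 1]mulr1.
have := @is_derive1_comp _ (dixonE R) (fun x : R => x ^+ 3) x _ _ h h3.
by rewrite [_ * (3 * _)]mulrC.
Qed.

Lemma is_derive_dixonEN_cube x : 0 <= x ^+ 3 <= a ->
  is_derive x 1 (fun x : R => dixonE R (- x ^+ 3)) (- (3 * x ^+ 2 * dixonE' R (- x ^+ 3))).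
Proof.
move=> xa; have x7N : `|- x ^+ 3| < 7 by rewrite normrN x7.
have h := is_derive_dixonE R (- x ^+ 3) x7N.
have h3 : is_derive x 1 (fun x : R => - x ^+ 3) (- (3 * x ^+ 2)).
  have := is_deriveN (is_deriveX 3 (is_derive_id x (1 : R))); rewrite exprfctE.
  by rewrite [_ *: 1]mulr1.
have := @is_derive1_comp _ (dixonE R) (fun x : R => - x ^+ 3) x _ _ h h3.
by rewrite mulrN [_ * (3 * _)]mulrC.
Qed.

(** The numerator of the quotient rule, E(-x^3) + 3 x^3 E'(-x^3), equals E(x^3)^2 by the
    differential equation at -x^3. *)
Lemma is_derive_dixon_sm x : 0 <= x ^+ 3 <= a ->
  is_derive x 1 dixon_sm (dixon_cm x ^+ 2).
Proof.
move=> xa; have b0 := lt0r_neq0 (dixonEN_gt0 _ xa).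
have hV : is_derive x 1 (fun z : R => (dixonE R (- z ^+ 3))^-1) _ :=
  @is_deriveV _ (fun z : R => dixonE R (- z ^+ 3)) x _ 1 b0 (is_derive_dixonEN_cube _ xa).
have := is_deriveM (is_derive_id x (1 : R)) hV.
have x7N : `|- x ^+ 3| < 7 by rewrite normrN x7.
have := dixonE_ode R (- x ^+ 3) x7N; rewrite opprK => ode h.
apply: is_derive_eq h _; rewrite /GRing.scale /=.
rewrite /dixon_cm expr_div_n.
have -> : dixonE R (x ^+ 3) ^+ 2 = dixonE R (- x ^+ 3) - 3 * - x ^+ 3 * dixonE' R (- x ^+ 3).
  by rewrite ode opprB addrC subrK.
by field.
Qed.

Lemma continuous_dixon_cm x : 0 <= x ^+ 3 <= a -> {for x, continuous dixon_cm}.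
Proof.
move=> xa; have b0 := lt0r_neq0 (dixonEN_gt0 _ xa).
have := is_deriveM (is_derive_dixonE_cube _ xa)
  (@is_deriveV _ (fun z : R => dixonE R (- z ^+ 3)) x _ 1 b0 (is_derive_dixonEN_cube _ xa)).
by case=> /derivable1_diffP/differentiable_continuous.
Qed.
End DixonSine.

(** * The integral theta *)

Definition theta_integrand (R : realType) (u : R) : R :=
  ((1 - u ^+ 3) `^ (2%:R / 3%:R))^-1.

Lemma continuous_theta_integrand (R : realType) (u : R) : u < 1 ->
  {for u, continuous (theta_integrand R)}.
Proof.
move=> u1; have u3 : 0 < 1 - u ^+ 3.
  (* Completing the square in 1 + u + u^2 handles negative u too, so the integrand is continuous on
     a full neighbourhood of 0. *)
  have -> : 1 - u ^+ 3 = (1 - u) * ((u + 1 / 2) ^+ 2 + 3 / 4) by field.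
  by apply: mulr_gt0; [lra | have := sqr_ge0 (u + 1 / 2); lra].
apply: cvgV; first by rewrite gt_eqF // powR_gt0.
have h3 : {for u, continuous (fun u : R => 1 - u ^+ 3)}.
  apply: cvgB; first exact: cvg_cst.
  exact: exprn_continuous.
have h4 : {for 1 - u ^+ 3, continuous (fun t : R => t `^ (2%:R / 3%:R))}.
  by case: (is_derive1_powR (2%:R / 3%:R) u3) => /derivable1_diffP/differentiable_continuous.
exact: (@continuous_comp _ _ _ (fun u : R => 1 - u ^+ 3) (fun t : R => t `^ (2%:R / 3%:R)) u h3 h4).
Qed.

Lemma theta_integrand_cube (R : realType) (u v : R) : 0 <= v -> u ^+ 3 + v ^+ 3 = 1 ->
  theta_integrand R u = (v ^+ 2)^-1.
Proof.
move=> v0 uv; have v3 : 1 - u ^+ 3 = v ^+ 3 by rewrite -uv addrC addKr.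
rewrite /theta_integrand v3 -(powR_mulrn 3) // -powRrM.
by rewrite mulrCA mulfV // mulr1 powR_mulrn.
Qed.

Section ThetaCube.
Variables (R : realType) (a : R).
Hypotheses (a06 : 0 < a <= 6) (Ea : dixonE R a = 0).
Hypothesis E_gt0 : forall y, 0 <= y < a -> 0 < dixonE R y.

Let sm := dixon_sm R.
Let cm := dixon_cm R.

Let is_derive_sm x (xa : 0 <= x ^+ 3 <= a) : is_derive x 1 sm (cm x ^+ 2).
Proof. exact: is_derive_dixon_sm a06 Ea E_gt0 x xa. Qed.

Let cm_gt0 x : 0 <= x ^+ 3 < a -> 0 < cm x.
Proof.
move=> /andP[x0 xa]; apply: divr_gt0; first by apply: E_gt0; rewrite x0.
by apply: (dixonEN_gt0 _ _ a06 Ea E_gt0); rewrite x0 ltW.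
Qed.

Let sm_cm x (xa : 0 <= x ^+ 3 <= a) : sm x ^+ 3 + cm x ^+ 3 = 1.
Proof. exact: dixon_sm_cm_cube a06 Ea E_gt0 x xa. Qed.

Let sm_lt1 x : 0 <= x ^+ 3 < a -> sm x < 1.
Proof.
move=> xa; have c0 := cm_gt0 _ xa; have xa' : 0 <= x ^+ 3 <= a by lra.
rewrite ltNge; apply/negP => s1; have := sm_cm _ xa'.
have : 0 < cm x ^+ 3 by exact: exprn_gt0.
have : 1 <= sm x ^+ 3 by exact: exprn_ege1.
lra.
Qed.

Let itv_cube x y : 0 <= y <= x -> x ^+ 3 < a -> 0 <= y ^+ 3 < a.
Proof.
move=> /andP[y0 yx] xa; rewrite exprn_ge0 //= (le_lt_trans _ xa) //.
by rewrite lerXn2r ?nnegrE // (le_trans y0).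
Qed.

Let sm_derive1 x : 0 <= x ^+ 3 <= a -> derive1 sm x = cm x ^+ 2.
Proof. by move=> xa; rewrite derive1E; case: (is_derive_sm x xa). Qed.

Let continuous_sm x : 0 <= x ^+ 3 <= a -> {for x, continuous sm}.
Proof.
by move=> xa; case: (is_derive_sm x xa) => /derivable1_diffP/differentiable_continuous.
Qed.

Let continuous_cm2 x : 0 <= x ^+ 3 <= a -> (fun x => cm x ^+ 2) y @[y --> x] --> cm x ^+ 2.
Proof.
by move=> xa; have h := continuous_dixon_cm _ _ a06 Ea E_gt0 x xa; exact: (cvgM h h).
Qed.

Lemma dixon_sm_lt x y : 0 <= y -> y < x -> x ^+ 3 <= a -> sm y < sm x.
Proof.
move=> y0 yx xa; have x0 : 0 < x by lra.
have zitv z : 0 <= z <= x -> 0 <= z ^+ 3 <= a.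
  move=> /andP[z0 zx]; rewrite exprn_ge0 //= (le_trans _ xa) //.
  by rewrite lerXn2r ?nnegrE // (le_trans z0).
have zitv' z : 0 <= z < x -> 0 <= z ^+ 3 < a.
  move=> /andP[z0 zx]; rewrite exprn_ge0 //= (lt_le_trans _ xa) //.
  by rewrite ltrXn2r ?nnegrE // ltW.
apply: (@gtr0_derive1_incr _ sm 0 x) => //.
- move=> z; rewrite in_itv /= => /andP[z0 zx].
  by case: (is_derive_sm z (zitv z _)) => //; rewrite !ltW.
- move=> z; rewrite in_itv /= => /andP[z0 zx].
  by rewrite sm_derive1 ?zitv ?exprn_gt0 ?cm_gt0 ?zitv' ?z0 ?zx ?ltW.
- apply: continuous_in_subspaceT => z; rewrite inE /= in_itv /= => zx.
  exact: continuous_sm (zitv z zx).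
Qed.

(** The substitution u = sm t has du = cm^2 dt and turns the integrand into cm^-2, so 1 is
    integrated over [0, x]. The end point stays below sm = 1, near which the integrand is
    unbounded. *)
Lemma integral_theta_integrand_sm x : 0 < x -> x ^+ 3 < a ->
  (\int[@lebesgue_measure R]_(u in `[0%R, sm x]) (theta_integrand R u)%:E = x%:E)%E.
Proof.
move=> x0 xa.
have zitv z : 0 <= z <= x -> 0 <= z ^+ 3 < a by move=> /itv_cube; exact.
have zitvW z : 0 <= z <= x -> 0 <= z ^+ 3 <= a by move=> /zitv/andP[-> /ltW].
have sm0 : sm 0 = 0 by rewrite /sm /dixon_sm mul0r.
have near_der z : 0 < z < x -> \forall y \near z, cm y ^+ 2 = derive1 sm y.
  move=> zx; have : z \in `]0, x[ by rewrite in_itv.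
  move=> /near_in_itvoo; apply: filterS => y; rewrite in_itv /= => /andP[y0 yx].
  by rewrite sm_derive1 // zitvW // !ltW.
have x00 : (0 : R) <= 0 <= x by lra.
have xx : 0 <= x <= x by lra.
have := @integration_by_substitution_increasing R sm (theta_integrand R) 0 x (ltW x0).
rewrite sm0 => ->.
- rewrite (eq_integral (fun=> 1%E)); last first.
    move=> z; rewrite inE /= in_itv /= => zx; congr EFin => /=.
    have c0 := cm_gt0 _ (zitv z zx).
    transitivity (theta_integrand R (sm z) * derive1 sm z) => //.
    rewrite (theta_integrand_cube _ _ (cm z) (ltW c0) (sm_cm _ (zitvW z zx))).
    by rewrite sm_derive1 ?zitvW // mulVf // expf_neq0 // gt_eqF.
  rewrite integral_cst //= mul1e lebesgue_measure_itv /= lte_fin x0.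
  by rewrite -EFinB subr0.
- move=> y z; rewrite !in_itv /= => /andP[y0 yx] zx yz.
  by apply: dixon_sm_lt => //; have /andP[_ /ltW] := zitv z zx.
- move=> z; rewrite in_itv /= => zx.
  have zx' : 0 <= z <= x by lra.
  rewrite /continuous_at sm_derive1 ?zitvW //.
  by apply: cvg_trans (continuous_cm2 z (zitvW z zx')); apply: near_eq_cvg; exact: near_der.
- apply/cvg_ex; exists (cm 0 ^+ 2).
  have h := cvg_at_right_filter (continuous_cm2 0 (zitvW 0 x00)).
  apply: cvg_trans h; apply: near_eq_cvg; near=> y.
  rewrite sm_derive1 // zitvW //; apply/andP; split; first by near: y; exact: nbhs_right_ge.
  by near: y; exact: nbhs_right_le.
- apply/cvg_ex; exists (cm x ^+ 2).
  have h := cvg_at_left_filter (continuous_cm2 x (zitvW x xx)).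
  apply: cvg_trans h; apply: near_eq_cvg; near=> y.
  rewrite sm_derive1 // zitvW //; apply/andP; split; first by near: y; exact: nbhs_left_ge.
  by near: y; exact: nbhs_left_le.
- split.
  + move=> z; rewrite in_itv /= => zx; have zx' : 0 <= z <= x by lra.
    by case: (is_derive_sm z (zitvW z zx')).
  + exact: cvg_at_right_filter (continuous_sm 0 (zitvW 0 x00)).
  + exact: cvg_at_left_filter (continuous_sm x (zitvW x xx)).
- apply: continuous_in_subspaceT => z; rewrite inE /= in_itv /= => /andP[_ zx].
  apply: continuous_theta_integrand; apply: le_lt_trans zx _.
  exact: sm_lt1 (zitv x xx).
Unshelve. all: by end_near. Qed.
(** Monotone convergence: the intervals [0, sm x_n], over which the integral is x_n, exhaust [0, 1)
    as x_n rises to the cube root of a. *)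
Lemma theta_cube : theta R ^+ 3 = a.
Proof.
have /andP[a0 a6] := a06.
pose al := a `^ 3%:R^-1.
have al0 : 0 < al by exact: powR_gt0.
have al3 : al ^+ 3 = a.
  by rewrite -powR_mulrn ?powR_ge0 // -powRrM mulVf // powRr1 // ltW.
suff -> : theta R = al by [].
have al3a : 0 <= al ^+ 3 <= a by rewrite al3 lexx ltW.
(* The shift by 2 makes already [x 0] positive. *)
pose x (n : nat) : R := al * (1 - n.+2%:R^-1).
have inv_lt1 n : 0 < (n.+2%:R^-1 : R) < 1.
  by rewrite invr_gt0 ltr0n /= invf_lt1 // ltr1n.
have x0 n : 0 < x n by rewrite mulr_gt0 // subr_gt0; case/andP: (inv_lt1 n).
have xal n : x n < al by rewrite gtr_pMr // gtrBl; case/andP: (inv_lt1 n).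
have x3 n : x n ^+ 3 < a by rewrite -al3 ltrXn2r ?nnegrE // ltW.
have xmono m n : (m <= n)%N -> x m <= x n.
  move=> mn; rewrite ler_pM2l // lerD2l lerN2 lef_pV2 ?posrE // ler_nat.
  by rewrite !ltnS.
have cvgx : x @ \oo --> al.
  rewrite -[al]mulr1 -[1 in X in _ --> X]subr0.
  apply: cvgM; first exact: cvg_cst.
  apply: cvgB; first exact: cvg_cst.
  have := @cvg_harmonic R; rewrite -(cvg_shiftS _ _); exact.
(* E(a) = 0 makes cm vanish here, so sm^3 = 1. *)
have sm1 : sm al = 1.
  have := sm_cm _ al3a; rewrite /cm /dixon_cm al3 Ea mul0r expr0n /= addr0 => /eqP.
  rewrite pexpr_eq1 //; first by move/eqP.
  have := dixon_sm_lt al 0 (lexx 0) al0; rewrite al3 => /(_ (lexx a))/ltW.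
  by rewrite /sm /dixon_sm mul0r al3.
have cvgsm : (fun n => sm (x n)) @ \oo --> (1 : R).
  by rewrite -sm1; apply: continuous_cvg cvgx; exact: continuous_sm.
have sm_mono m n : (m <= n)%N -> sm (x m) <= sm (x n).
  move=> /xmono; rewrite le_eqVlt => /orP[/eqP->//|xmn].
  by apply/ltW/dixon_sm_lt => //; apply/ltW.
pose F (n : nat) : set R := `[0, sm (x n)]%classic.
have UF : \bigcup_n F n = `[0, 1[%classic.
  apply/seteqP; split => u.
    move=> [n _]; rewrite /F /= !in_itv /= => /andP[-> us] /=.
    by apply: le_lt_trans us _; apply: sm_lt1; rewrite x3 andbT exprn_ge0 // ltW.
  rewrite /= in_itv /= => /andP[u0 u1].
  have [N _ hN] := cvgr_gt _ cvgsm _ u1.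
  by exists N => //; rewrite /F /= in_itv /= u0 /= ltW //; apply: hN => /=.
have cont u : u < 1 -> {for u, continuous (theta_integrand R)} by exact: continuous_theta_integrand.
have meas (A : set R) : measurable A -> (forall u, A u -> u < 1) ->
    measurable_fun A (theta_integrand R).
  move=> mA A1; apply: subspace_continuous_measurable_fun => //.
  by apply: continuous_in_subspaceT => u; rewrite inE => /A1; exact: cont.
rewrite /theta /Rintegral integral_itv_obnd_cbnd; last first.
  apply/measurable_EFinP.
  by apply: meas => // u; rewrite /= in_itv /= => /andP[].
rewrite -UF.
have F1 n u : F n u -> u < 1.
  rewrite /F /= in_itv /= => /andP[_ us].
  by apply: le_lt_trans us _; apply: sm_lt1; rewrite x3 andbT exprn_ge0 // ltW.
have cvgI : (\int[@lebesgue_measure R]_(u in F n) (theta_integrand R u)%:E)%E @[n --> \oo] -->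
    (\int[@lebesgue_measure R]_(u in \bigcup_i F i) (theta_integrand R u)%:E)%E.
  apply: ge0_nondecreasing_set_cvg_integral.
  - apply/nondecreasing_seqP => n; rewrite subsetEset => u; rewrite /F /= !in_itv /=.
    by move=> /andP[-> /le_trans ->] //; exact: sm_mono.
  - by move=> n; exact: measurable_itv.
  - by move=> n; apply/measurable_EFinP; apply: meas; [exact: measurable_itv | exact: F1].
  - by move=> n u _; rewrite lee_fin invr_ge0 powR_ge0.
have cvgal :
    (\int[@lebesgue_measure R]_(u in F n) (theta_integrand R u)%:E)%E @[n --> \oo] --> al%:E.
  under eq_fun do rewrite integral_theta_integrand_sm //.
  by apply: cvg_EFin; [exact: nearW | exact: cvgx].
by rewrite (cvg_unique _ cvgI cvgal).
Qed.
End ThetaCube.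

(** * Two-sided bounds for the normalised moments *)

Section MomentBounds.
Variables (R : realType) (a : R) (s : nat -> R).
Hypotheses (a06 : 0 < a <= 6) (Ea : dixonE R a = 0).
Hypothesis hs : symmetric_moments (bstar R) s.

(* h_k is a partial sum of E(a) = 0, hence also minus a tail of the series. *)
Let h (k : nat) : R := (dixon_poly R k.+1).[a].
Let d (n : nat) : R := dixon_moment R s n * a ^+ n.

Let hS k : h k.+1 = h k + dixon_coef R k.+1 * a ^+ k.+1.
Proof. by rewrite /h !horner_poly [LHS]big_ord_recr. Qed.

(** Consecutive h_k differ by p_k a^k, so passing from n to n + 1 adds the convolution of p_k a^k
    with d at index n + 1, which is 0. *)
Let h_conv n : \sum_(i < n.+1) h i * d (n - i) = 1.
Proof.
have h0 : h 0 = 1 by rewrite /h horner_poly big_ord1 dixon_coef0 mulr1.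
have dconv n' : \sum_(i < n'.+1) (dixon_coef R i * a ^+ i) * d (n' - i) = (n' == 0%N)%:R.
  transitivity ((\sum_(i < n'.+1) dixon_coef R i * dixon_moment R s (n' - i)) * a ^+ n').
    rewrite mulr_suml; apply: eq_bigr => i _; rewrite mulrACA -exprD subnKC //.
    exact: leq_ord.
  by rewrite (dixon_moment_conv _ _ _ hs); case: n' => [|n'] /=; rewrite ?mul1r // mul0r.
elim: n => [|n IH].
  by have := dconv 0%N; rewrite !big_ord1 h0 dixon_coef0 expr0 mulr1.
have := dconv n.+1; rewrite big_ord_recl (_ : (n.+1 == 0%N)%:R = 0) // => dc.
rewrite -[RHS]addr0 -[X in _ = _ + X]dc -IH [LHS]big_ord_recl /= h0 dixon_coef0 expr0 mulr1 addrCA.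
congr (_ + _); rewrite -big_split; apply: eq_bigr => i _ /=.
by rewrite /bump /= add1n hS subSS mulrDl.
Qed.

Let a_le6 : 0 <= a <= 6. Proof. by move: a06; lra. Qed.

Let h_tail k : `|h k| <= 9 / 2 * (1 / 3) ^+ k.+1.
Proof. by have := dixonE_tail R a k.+1 a_le6; rewrite Ea sub0r normrN. Qed.

(** The bare tail bounds for k >= 1 add up to 3/4, which exceeds 1/2. So h_2 and then h_1 are
    reached backwards from |h_3| <= 1/18 with the exact p_3 and p_2, using 6^3/4536 = 1/21 and
    6^2/252 = 1/7. *)
Let h2_le : `|h 2| <= 1 / 18 + 1 / 21.
Proof.
have /andP[a0 a6] := a_le6.
have := h_tail 3; rewrite hS dixon_coef3.
have : a ^+ 3 <= 6 ^+ 3 by rewrite lerXn2r ?nnegrE.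
have := exprn_ge0 3 a0; rewrite !ler_norml; move: (a ^+ 3) (h 2) => y x; lra.
Qed.

Let h1_le : `|h 1| <= 1 / 18 + 1 / 21 + 1 / 7.
Proof.
have /andP[a0 a6] := a_le6.
have := h2_le; rewrite hS dixon_coef2.
have : a ^+ 2 <= 6 ^+ 2 by rewrite lerXn2r ?nnegrE.
have := exprn_ge0 2 a0; rewrite !ler_norml; move: (a ^+ 2) (h 1) => y x; lra.
Qed.

(** The indices 1 and 2 contribute 22/63, the tail bounds from 3 on add up to 1/12, and the total is
    109/252. The term subtracted in [hsum] is the part of the tail not yet consumed. *)
Let h_sum n : \sum_(i < n) `|h i.+1| <= 109 / 252.
Proof.
have hsum m : \sum_(i < m.+2) `|h i.+1| <= 109 / 252 - 3 / 4 * (1 / 3) ^+ m.+2.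
  elim: m => [|m IH].
    rewrite !big_ord_recr big_ord0 /=; have := h1_le; have := h2_le.
    have -> : (1 / 3 : R) ^+ 2 = 1 / 9 by lra.
    lra.
  rewrite big_ord_recr /=; have := h_tail m.+3.
  move: IH; rewrite !(exprS _ m.+2) !(exprS _ m.+3) !(exprS _ m.+2).
  move: (\sum_(i < m.+2) _) (_ ^+ m.+2) `|h m.+3| => x y z; lra.
apply: le_trans (_ : _ <= \sum_(i < n.+2) `|h i.+1|) _.
  by rewrite !big_ord_recr /= -addrA lerDl addr_ge0.
by apply: le_trans (hsum n) _; rewrite gerBl mulr_ge0 // exprn_ge0 //; lra.
Qed.

Let d_rec n : d n = 1 - \sum_(i < n) h i.+1 * d (n - i.+1).
Proof.
have := h_conv n; rewrite big_ord_recl /= subn0.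
have -> : h 0 = 1 by rewrite /h horner_poly big_ord1 dixon_coef0 mulr1.
by rewrite mul1r => <-; rewrite addrK.
Qed.

Let d_sum_le n D : (forall m, (m < n)%N -> `|d m| <= D) -> 0 <= D ->
  `|\sum_(i < n) h i.+1 * d (n - i.+1)| <= 109 / 252 * D.
Proof.
move=> hd D0; apply: le_trans (ler_norm_sum _ _ _) _.
apply: (@le_trans _ _ (\sum_(i < n) `|h i.+1| * D)).
  apply: ler_sum => i _; rewrite normrM ler_wpM2l // hd //.
  by rewrite ltn_subrL /= (leq_ltn_trans _ (ltn_ord i)).
by rewrite -mulr_suml ler_wpM2r.
Qed.

(** With rho = 109/252 one has 1/(1 - rho) = 252/143 and 1 - rho * 252/143 = 34/143. *)
Lemma dixon_moment_bounds n : 34 / 143 <= dixon_moment R s n * a ^+ n <= 252 / 143.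
Proof.
have D0 : 0 <= 252 / 143 :> R by lra.
have dn m : `|d m| <= 252 / 143.
  elim/ltn_ind: m => m IH; have := d_sum_le m _ IH D0.
  by rewrite d_rec !ler_norml; lra.
have := d_sum_le n _ (fun m _ => dn m) D0; rewrite -/(d n) d_rec ler_norml; lra.
Qed.
End MomentBounds.

(** * Gamma at half-integers against factorials *)

Lemma cvg_expRN_exprn (R : realType) k :
  (fun t : R => t ^+ k * expR (- t)) @ +oo --> (0 : R).
Proof.
apply/cvgrPdist_lt => e e0; near=> t.
have t0 : 0 < t by near: t; exact: nbhs_pinfty_gt.
have te : k.+1`!%:R / e < t by near: t; apply: nbhs_pinfty_gt; rewrite num_real.
rewrite sub0r normrN ger0_norm ?mulr_ge0 ?expR_ge0 ?exprn_ge0 ?ltW //.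
rewrite expRN ltr_pdivrMr ?expR_gt0 //.
apply: (@lt_le_trans _ _ (e * (t ^+ k.+1 / k.+1`!%:R))); last first.
  by apply: ler_wpM2l; [exact: ltW | apply: le_trans (expR_ge1Dxn k (ltW t0)); rewrite lerDr].
rewrite mulrA ltr_pdivlMr ?ltr0n ?fact_gt0 // exprS mulrA mulrC ltr_pM2r ?exprn_gt0 //.
by rewrite [e * t]mulrC -ltr_pdivrMr.
Unshelve. all: by end_near. Qed.

(** Integration by parts: F_(k+1) = -t^(k+1) e^-t + (k+1) F_k, with the constant fixed by the limit
    0 at infinity. *)
Lemma exprn_expRN_antiderivative (R : realType) k : exists F : R -> R,
  [/\ F 0 = - k`!%:R, forall t : R, is_derive t 1 F (t ^+ k * expR (- t)) & F @ +oo --> (0 : R)].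
Proof.
have dexp (t : R) : is_derive t 1 (fun t : R => expR (- t)) (- expR (- t)).
  have := @is_derive1_comp _ expR (fun t : R => - t) t _ _ (is_derive_expR _) (is_deriveNid t 1).
  by rewrite mulrN1.
elim: k => [|k [F [F0 dF Foo]]].
  exists (fun t => - expR (- t)); split; first by rewrite oppr0 expR0.
    by move=> t; have := is_deriveN (dexp t); rewrite opprK mul1r.
  by rewrite -oppr0; apply: cvgN; exact: cvgr_expR.
exists (fun t => - (t ^+ k.+1 * expR (- t)) + k.+1%:R * F t); split.
- by rewrite expr0n mul0r oppr0 add0r F0 mulrN -natrM -factS.
- move=> t.
  have dX : is_derive t 1 (fun t : R => t ^+ k.+1) (k.+1%:R * t ^+ k).
    have := is_deriveX k.+1 (is_derive_id t (1 : R)); rewrite exprfctE.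
    by rewrite [_ *: 1]mulr1.
  have := is_deriveD (is_deriveN (is_deriveM dX (dexp t))) (is_deriveZ k.+1%:R (dF t)).
  move=> h; apply: is_derive_eq h _; rewrite /GRing.scale /=; ring.
- rewrite (_ : 0 = - 0 + k.+1%:R * 0); last by rewrite oppr0 mulr0 addr0.
  apply: cvgD; first by apply: cvgN; exact: cvg_expRN_exprn.
  by apply: cvgM => //; exact: cvg_cst.
Qed.

Lemma continuous_exprn_expRN (R : realType) k : continuous (fun t : R => t ^+ k * expR (- t)).
Proof.
move=> t; apply: cvgM; first exact: exprn_continuous.
by apply: continuous_comp; [exact: opp_continuous | exact: continuous_expR].
Qed.

Lemma integral_exprn_expRN (R : realType) k :
  (\int[@lebesgue_measure R]_(t in `]0%R, +oo[) (t ^+ k * expR (- t))%:E = k`!%:R%:E)%E.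
Proof.
have [F [F0 dF Foo]] := exprn_expRN_antiderivative R k.
have cf := continuous_exprn_expRN R k.
rewrite integral_itv_obnd_cbnd; last first.
  apply/measurable_EFinP; by apply: measurable_funTS; exact: continuous_measurable_fun.
rewrite (@ge0_continuous_FTC2y R _ F 0 0); first by rewrite F0 sub0e -EFinN opprK.
- by move=> t t0; rewrite mulr_ge0 ?expR_ge0 ?exprn_ge0.
- exact: continuous_subspaceT.
- exact: Foo.
- by move=> t _; case: (dF t).
- by apply: cvg_at_right_filter; case: (dF 0) => /derivable1_diffP/differentiable_continuous.
- by move=> t _; rewrite derive1E; case: (dF t).
Qed.

(** The integrand is t^k sqrt(t) e^-t. From sqrt(t) <= 1 + t comes the upper bound k! + (k+1)!; from
    t <= t sqrt(t) + 1 comes k! <= Gamma + (k-1)!, where (k-1)! <= k!/2. *)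
Lemma Gamma_half_bounds (R : realType) k : (2 <= k)%N ->
  k`!%:R / 2 <= Gamma (k%:R + 3 / 2 : R) <= 2 * k.+1`!%:R.
Proof.
move=> k2; rewrite /Gamma /Rintegral.
set I := (X in fine X).
have tE (t : R) : 0 < t -> t `^ (k%:R + 3 / 2 - 1) = t ^+ k * Num.sqrt t.
  move=> t0; rewrite (_ : k%:R + 3 / 2 - 1 = k%:R + 2^-1); last by lra.
  by rewrite powRD ?gt_eqF ?implybT // powR_mulrn ?ltW // powR12_sqrt ?ltW.
have IE : I = (\int[@lebesgue_measure R]_(t in `]0%R, +oo[)
    (t ^+ k * Num.sqrt t * expR (- t))%:E)%E.
  by apply: eq_integral => t; rewrite inE /= in_itv /= andbT => t0; rewrite tE.
pose D : set R := `]0, +oo[%classic.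
have mE (j : nat) : measurable_fun D (fun t : R => (t ^+ j * expR (- t))%:E).
  apply/measurable_EFinP; apply: measurable_funTS; apply: continuous_measurable_fun.
  exact: continuous_exprn_expRN.
have ms : measurable_fun D (fun t : R => (t ^+ k * Num.sqrt t * expR (- t))%:E).
  apply/measurable_EFinP; apply: measurable_funTS; apply: continuous_measurable_fun => t.
  rewrite (_ : (fun _ => _) = (fun t : R => Num.sqrt t * (t ^+ k * expR (- t)))); last first.
    by apply/funext => x; rewrite [_ ^+ k * _]mulrC mulrA.
  by apply: cvgM; [exact: sqrt_continuous | exact: continuous_exprn_expRN].
have g0 j (t : R) : 0 < t -> 0 <= t ^+ j * expR (- t).
  by move=> t0; rewrite mulr_ge0 ?expR_ge0 ?exprn_ge0 ?ltW.
have s0 (t : R) : 0 < t -> 0 <= t ^+ k * Num.sqrt t * expR (- t).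
  by move=> t0; rewrite mulr_ge0 ?expR_ge0 // mulr_ge0 ?exprn_ge0 ?sqrtr_ge0 ?ltW.
have I_le : (I <= (k`!%:R + k.+1`!%:R)%:E)%E.
  rewrite EFinD -!integral_exprn_expRN -ge0_integralD //=; last 4 first.
  - by move=> t; rewrite in_itv /= andbT => t0; rewrite lee_fin g0.
  - exact: mE.
  - by move=> t; rewrite in_itv /= andbT => t0; rewrite lee_fin g0.
  - exact: mE.
  rewrite IE; apply: ge0_le_integral => //=.
  - by move=> t; rewrite in_itv /= andbT => t0; rewrite lee_fin s0.
  - by apply: emeasurable_funD => //; exact: mE.
  - move=> t; rewrite in_itv /= andbT => t0; rewrite -EFinD lee_fin -mulrDl.
    rewrite ler_wpM2r ?expR_ge0 // (_ : _ + _ = t ^+ k * (1 + t)); last by rewrite exprSr; ring.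
    rewrite ler_wpM2l ?exprn_ge0 ?ltW //.
    by have := sqr_sqrtr (ltW t0); have := sqrtr_ge0 t; move: (Num.sqrt t) => r r0 <-; nra.
have I_ge : ((k`!%:R)%:E <= I + (k.-1`!%:R)%:E)%E.
  rewrite -!integral_exprn_expRN IE -ge0_integralD //=; last 3 first.
  - by move=> t; rewrite in_itv /= andbT => t0; rewrite lee_fin s0.
  - by move=> t; rewrite in_itv /= andbT => t0; rewrite lee_fin g0.
  - exact: mE.
  apply: ge0_le_integral => //=.
  - by move=> t; rewrite in_itv /= andbT => t0; rewrite lee_fin g0.
  - exact: mE.
  - by apply: emeasurable_funD => //; exact: mE.
  - move=> t; rewrite in_itv /= andbT => t0; rewrite -EFinD lee_fin -mulrDl.
    have tk : t ^+ k = t ^+ k.-1 * t by rewrite -exprSr prednK // ltnW.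
    rewrite ler_wpM2r ?expR_ge0 // (_ : _ + _ = t ^+ k.-1 * (t * Num.sqrt t + 1));
      last by rewrite tk; ring.
    rewrite tk ler_wpM2l ?exprn_ge0 ?ltW //.
    have := sqr_sqrtr (ltW t0); have := sqrtr_ge0 t; move: (Num.sqrt t) => r r0 <-.
    by have [r1|r1] := leP 1 r; nra.
(* [fine] would send an infinite integral to 0, so finiteness has to precede the transfer of the
   bounds to real numbers. *)
have I_fin : I \is a fin_num.
  rewrite ge0_fin_numE; first exact: le_lt_trans I_le (ltry _).
  rewrite IE; apply: integral_ge0 => t; rewrite /= in_itv /= andbT => t0.
  by rewrite lee_fin s0.
move: I_le I_ge; rewrite -(fineK I_fin) -EFinD !lee_fin /=.
have k1 : (0 < k)%N by exact: ltnW.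
have kf : k`!%:R = k%:R * k.-1`!%:R :> R by rewrite -natrM -{1}(prednK k1) factS prednK.
have f0 : 0 <= k.-1`!%:R :> R by [].
have kge : 2 <= k%:R :> R by rewrite ler_nat.
have kk : k`!%:R <= k.+1`!%:R :> R by rewrite ler_nat factS leq_pmull.
have : 2 * k.-1`!%:R <= k`!%:R :> R by rewrite kf ler_wpM2r.
lra.
Qed.

(** * Logarithmic estimates and n-th roots *)

Lemma ln_le_sub1 (R : realType) (x : R) : 0 < x -> ln x <= x - 1.
Proof.
move=> x0; rewrite (_ : ln x = ln (1 + (x - 1))); last by congr ln; ring.
by apply: le_ln1Dx; lra.
Qed.

Lemma ln_le_sqrt (R : realType) (x : R) : 1 <= x -> ln x <= 2 * Num.sqrt x.
Proof.
move=> x1; have s0 : 0 < Num.sqrt x by rewrite sqrtr_gt0; lra.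
rewrite -{1}(sqr_sqrtr (_ : 0 <= x)); last by lra.
by rewrite lnXn // -[_ *+ 2]mulr_natl; have := ln_le_sub1 _ _ s0; lra.
Qed.

(** Elementary Stirling: m ln(1 + 1/m) <= 1 <= (m + 1) ln(1 + 1/m) controls the increment from both
    sides. *)
Lemma ln_fact_bounds (R : realType) m : (1 <= m)%N ->
  m%:R * ln m%:R - m%:R <= ln (m`!%:R : R) <= m%:R * ln m%:R - m%:R + 1 + ln m%:R.
Proof.
elim: m => // -[|m] IH _; first by rewrite ln1; lra.
have /andP[lo hi] := IH isT.
have f0 : 0 < m.+1`!%:R :> R by rewrite ltr0n fact_gt0.
rewrite factS natrM lnM ?posrE ?ltr0n ?fact_gt0 //.
have m0 : 0 < m.+1%:R :> R by rewrite ltr0n.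
have m1 : 0 < m.+2%:R :> R by rewrite ltr0n.
have mS : m.+2%:R = m.+1%:R + 1 :> R by rewrite natr1.
have up : m.+1%:R * (ln m.+2%:R - ln m.+1%:R) <= 1 :> R.
  rewrite -ln_div ?posrE //.
  apply: (@le_trans _ _ (m.+1%:R * (m.+2%:R / m.+1%:R - 1))); last first.
    by rewrite mulrBr mulrCA mulfV ?gt_eqF // mS; lra.
  by apply: ler_wpM2l; [exact: ltW | apply: ln_le_sub1; rewrite divr_gt0].
have dn : m.+2%:R * (ln m.+1%:R - ln m.+2%:R) <= - 1 :> R.
  rewrite -ln_div ?posrE //.
  apply: (@le_trans _ _ (m.+2%:R * (m.+1%:R / m.+2%:R - 1))); last first.
    by rewrite mulrBr mulrCA mulfV ?gt_eqF // mS; lra.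
  by apply: ler_wpM2l; [exact: ltW | apply: ln_le_sub1; rewrite divr_gt0].
move: lo hi up dn; rewrite mS.
move: (ln _`!%:R) (ln (m.+1%:R + 1)) (ln m.+1%:R) => z x y lo hi up dn.
by apply/andP; split; nra.
Qed.

Lemma ln_fact_sqrt (R : realType) m : (1 <= m)%N ->
  `|ln (m`!%:R : R) - (m%:R * ln m%:R - m%:R)| <= 3 * Num.sqrt m%:R.
Proof.
move=> m1; have m1R : 1 <= m%:R :> R by rewrite ler1n.
have := ln_fact_bounds R m m1; have := ln_le_sqrt _ _ m1R.
have : 1 <= Num.sqrt m%:R :> R by rewrite -[leLHS](@sqrtr1 R) ler_wsqrtr.
by rewrite ler_norml; lra.
Qed.

(** After taking logarithms and dividing by n, an error C sqrt(n) becomes C / sqrt(n); this is why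
    crude factorial bounds suffice. It serves with [kappa] = 3 for the moments and [kappa] = 0 for
    U_n. *)
Lemma cvg_powR_root (R : realType) (x : nat -> R) (kappa : nat) (lambda C : R) :
  (forall n, (1 <= n)%N -> 0 < x n) ->
  (forall n, (1 <= n)%N ->
     `|ln (x n) - n%:R * (kappa%:R * ln n%:R + lambda)| <= C * Num.sqrt n%:R) ->
  (fun n => x n `^ (n%:R^-1) / n%:R ^+ kappa) @ \oo --> expR lambda.
Proof.
move=> x0 hx; rewrite -(cvg_shiftS _ _) /=.
pose y n := ln (x n.+1) / n.+1%:R - kappa%:R * ln n.+1%:R.
have yE n : x n.+1 `^ (n.+1%:R^-1) / n.+1%:R ^+ kappa = expR (y n).
  rewrite /y expRB expRM_natl lnK ?posrE ?ltr0n //.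
  by rewrite /powR gt_eqF ?x0 //; congr (expR _ / _); exact: mulrC.
under eq_fun do rewrite yE.
apply: continuous_cvg; first exact: continuous_expR.
have y0 : (fun n => y n - lambda) @ \oo --> (0 : R).
  apply: (cvg0_le_norm _ _ (fun n => C * Num.sqrt (harmonic n))).
    move=> n; have n0 : 0 < n.+1%:R :> R by rewrite ltr0n.
    have -> : y n - lambda = (ln (x n.+1) - n.+1%:R * (kappa%:R * ln n.+1%:R + lambda)) / n.+1%:R.
      by rewrite /y; field; rewrite gt_eqF.
    rewrite normrM normfV (gtr0_norm n0) ler_pdivrMr //.
    apply: le_trans (hx n.+1 isT) _; rewrite /harmonic /= sqrtrV ?(ltW n0) // -mulrA.
    have sN : Num.sqrt n.+1%:R != 0 :> R by rewrite gt_eqF // sqrtr_gt0.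
    have -> : (Num.sqrt n.+1%:R)^-1 * n.+1%:R = Num.sqrt n.+1%:R :> R.
      by rewrite -[X in _ * X](sqr_sqrtr (ltW n0)) expr2 mulKf.
    exact: lexx.
  rewrite -[0](mulr0 C) -(sqrtr0 R); apply: cvgM; first exact: cvg_cst.
  apply: continuous_cvg; first exact: sqrt_continuous.
  exact: (@cvg_harmonic R).
have yl : y = (fun n => (y n - lambda) + lambda) by apply/funext => n; rewrite subrK.
rewrite yl -[X in _ --> X]add0r; apply: cvgD; [exact: y0 | exact: cvg_cst].
Qed.

(** Both parities grow like (3i/2)^3. An upper shift by 1 fails for even i = 2m, since
    (3m+1)(3m+2)^2 > (3m + 3/2)^3; the shift by 2 costs only a polynomial factor in the product. *)
Lemma bstar_sqr_bounds (R : realType) i :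
  (3 / 2 * i%:R) ^+ 3 <= bstar R i ^+ 2 <= (3 / 2 * i.+2%:R) ^+ 3.
Proof.
have [m [->|->]] : exists m, i = (2 * m)%N \/ i = (2 * m.+1 - 1)%N.
  by exists i./2; have := odd_double_half i; case: (odd i) => /= h; [right|left]; lia.
  have -> : bstar R (2 * m) ^+ 2 = (3 * m%:R + 1) * (3 * m%:R + 2) ^+ 2.
    by rewrite bstar_even exprMn sqr_sqrtr // (natrD _ (3 * m) 1) (natrD _ (3 * m) 2) natrM.
  rewrite -(addn2 (2 * m)) (natrD _ (2 * m)) natrM.
  have : 0 <= m%:R :> R by []; move: m%:R => t t0.
  apply/andP; split; rewrite -subr_ge0.
    rewrite (_ : _ - _ = 45 * t ^+ 2 + 24 * t + 4); last by field.
    by rewrite !addr_ge0 ?mulr_ge0 ?sqr_ge0.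
  rewrite (_ : _ - _ = 36 * t ^+ 2 + 57 * t + 23); last by field.
  by rewrite !addr_ge0 ?mulr_ge0 ?sqr_ge0.
have -> : bstar R (2 * m.+1 - 1) ^+ 2 = (3 * m.+1%:R) ^+ 2 * (3 * m.+1%:R + 1).
  by rewrite bstar_odd // exprMn sqr_sqrtr // natrD natrM.
have -> : (2 * m.+1 - 1).+2%:R = 2 * m.+1%:R + 1 :> R.
  by rewrite (_ : (2 * m.+1 - 1).+2 = (2 * m.+1 + 1)%N) ?(natrD _ (2 * m.+1)) ?natrM //; lia.
rewrite natrB ?natrM; last by lia.
have : 1 <= m.+1%:R :> R by rewrite ler1n.
move: m.+1%:R => t t0.
have t2 : t <= t ^+ 2 by rewrite expr2 ler_peMl //; lra.
apply/andP; split; rewrite -subr_ge0.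
  rewrite (_ : _ - _ = 99 / 2 * t ^+ 2 - 81 / 4 * t + 27 / 8); last by field.
  lra.
rewrite (_ : _ - _ = 63 / 2 * t ^+ 2 + 81 / 4 * t + 27 / 8); last by field.
lra.
Qed.

Lemma bstar_prod_lower (R : realType) n :
  ((3 / 2) ^+ n * n`!%:R) ^+ 3 <= \prod_(i < n.+1) bstar R i ^+ 2.
Proof.
elim: n => [|n IH].
  (* The lower bound for b_0^2 is 0 and would kill the product, so b_0^2 = 4 >= 1 is used and the
     factorial starts at i = 1. *)
  rewrite big_ord1 expr0 mul1r expr1n (bstar_even R 0) muln0 !add0n sqrtr1 mul1r; lra.
rewrite big_ord_recr /= factS natrM (exprS _ n).
rewrite (_ : _ ^+ 3 = ((3 / 2) ^+ n * n`!%:R) ^+ 3 * (3 / 2 * n.+1%:R) ^+ 3); last first.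
  by rewrite -exprMn; congr (_ ^+ _); move: ((3 / 2) ^+ n) => u; ring.
apply: ler_pM => //.
by case/andP: (bstar_sqr_bounds R n.+1).
Qed.

Lemma bstar_prod_upper (R : realType) n :
  \prod_(i < n) bstar R i ^+ 2 <= ((3 / 2) ^+ n * n.+1`!%:R) ^+ 3.
Proof.
elim: n => [|n IH]; first by rewrite big_ord0 expr0 mul1r expr1n.
rewrite big_ord_recr /= [n.+2`!]factS natrM (exprS _ n).
rewrite (_ : (_ * _) ^+ 3 = ((3 / 2) ^+ n * n.+1`!%:R) ^+ 3 * (3 / 2 * n.+2%:R) ^+ 3); last first.
  by rewrite -exprMn; congr (_ ^+ _); move: ((3 / 2) ^+ n) => u; ring.
apply: ler_pM => //; first by rewrite prodr_ge0 // => i _; rewrite sqr_ge0.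
  by rewrite sqr_ge0.
by case/andP: (bstar_sqr_bounds R n).
Qed.

Lemma sqrt_le_double (R : realType) (x y : R) : 0 <= y -> x <= 4 * y ->
  Num.sqrt x <= 2 * Num.sqrt y.
Proof.
move=> y0 xy; have -> : 2 * Num.sqrt y = Num.sqrt (4 * y).
  by rewrite sqrtrM // (_ : 4 = 2 ^+ 2) ?sqrtr_sqr ?ger0_norm //; lra.
exact: ler_wsqrtr.
Qed.

Lemma ln_bstar_prod (R : realType) n : (1 <= n)%N ->
  `|ln (\prod_(i < n) bstar R i ^+ 2) - n%:R * (3 * ln n%:R + 3 * (ln (3 / 2) - 1))|
    <= 21 * Num.sqrt n%:R.
Proof.
case: n => // n _; have h32 : 0 < 3 / 2 :> R by lra.
have pow0 m : 0 < (3 / 2 : R) ^+ m by exact: exprn_gt0.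
have fact0 m : 0 < m`!%:R :> R by rewrite ltr0n fact_gt0.
have lnpf m k : ln (((3 / 2 : R) ^+ m * k`!%:R) ^+ 3) = 3 * (m%:R * ln (3 / 2) + ln k`!%:R).
  rewrite lnXn ?mulr_gt0 // lnM ?posrE // lnXn //.
  by rewrite -[_ *+ 3]mulr_natl -[_ *+ m]mulr_natl.
have lo := bstar_prod_lower R n; have up := bstar_prod_upper R n.+1.
have P0 : 0 < \prod_(i < n.+1) bstar R i ^+ 2.
  by apply: lt_le_trans lo; rewrite exprn_gt0 // mulr_gt0.
rewrite -ler_ln ?posrE ?exprn_gt0 ?mulr_gt0 // lnpf in lo.
rewrite -ler_ln ?posrE ?exprn_gt0 ?mulr_gt0 // lnpf in up.
have n0 : 0 < n.+1%:R :> R by rewrite ltr0n.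
have f1 : ln n.+1`!%:R = ln n.+1%:R + ln n`!%:R :> R by rewrite factS natrM lnM ?posrE.
have f2 : ln n.+2`!%:R = ln n.+2%:R + ln n.+1`!%:R :> R.
  by rewrite factS natrM lnM ?posrE // ltr0n.
have n1 : 1 <= n.+1%:R :> R by rewrite ler1n.
have n2 : 1 <= n.+2%:R :> R by rewrite ler1n.
have := ln_fact_bounds R n.+1 isT; have := ln_le_sqrt _ _ n1; have := ln_le_sqrt _ _ n2.
have : Num.sqrt n.+2%:R <= 2 * Num.sqrt n.+1%:R :> R.
  by apply: sqrt_le_double => //; rewrite -(natr1 n.+1); lra.
have : 1 <= Num.sqrt n.+1%:R :> R by rewrite -[leLHS](@sqrtr1 R) ler_wsqrtr.
have := ln_le_sub1 _ _ h32; have : 0 <= ln (3 / 2 : R) by apply: ln_ge0; lra.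
move: lo up; rewrite f2 f1 -(natr1 n) ler_norml.
move: n%:R (ln (\prod_(i < n.+1) bstar R i ^+ 2)) (ln (n%:R + 1)) (ln n`!%:R) (ln n.+2%:R)
  (Num.sqrt n.+2%:R) (Num.sqrt (n%:R + 1)) (ln (3 / 2)) => t P x y z u v w.
move=> *; apply/andP; split; lra.
Qed.

Lemma ln_moment_estimate (R : realType) (a : R) (s : nat -> R) n : 0 < a -> (1 <= n)%N ->
  34 / 143 <= dixon_moment R s n * a ^+ n <= 252 / 143 ->
  `|ln (s (2 * n)%N) - n%:R * (3 * ln n%:R + (3 * ln 3 - 3 - ln a))| <= 14 * Num.sqrt n%:R.
Proof.
move=> a0 n1; set d := dixon_moment R s n * a ^+ n => /andP[d1 d2].
have d0 : 0 < d by lra.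
have f0 m : 0 < m`!%:R :> R by rewrite ltr0n fact_gt0.
have n0 : 0 < n%:R :> R by rewrite ltr0n.
have sE : s (2 * n)%N = d / a ^+ n * (3 * n + 1)`!%:R.
  by rewrite /d mulfK ?expf_neq0 ?gt_eqF // /dixon_moment divfK // gt_eqF.
have k0 : 0 < (3 * n)%:R :> R by rewrite ltr0n; lia.
have k1 : 0 < (3 * n + 1)%:R :> R by rewrite ltr0n; lia.
rewrite sE lnM ?posrE ?divr_gt0 ?exprn_gt0 // ln_div ?posrE ?exprn_gt0 // lnXn //.
have fE : (3 * n + 1)`!%:R = (3 * n + 1)%:R * (3 * n)`!%:R :> R.
  by rewrite -natrM addn1 -factS.
rewrite -[_ *+ n]mulr_natl fE lnM ?posrE //.
have dln : ln d <= 1 by have := ln_le_sub1 _ _ d0; lra.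
(* The inequality ln x <= x - 1 at 1/d gives -ln d <= 143/34 - 1 < 4. *)
have dln' : - 4 <= ln d.
  have dV : 0 < d^-1 by rewrite invr_gt0.
  have := ln_le_sub1 _ _ dV; rewrite lnV ?posrE //.
  have : d^-1 <= 143 / 34 by rewrite -[leRHS]invrK lef_pV2 ?posrE ?invr_gt0 //; lra.
  lra.
have kE : (3 * n)%:R = 3 * n%:R :> R by rewrite natrM.
have kn : (1 <= 3 * n)%N by rewrite muln_gt0.
have := ln_fact_sqrt R (3 * n) kn.
have k11 : 1 <= (3 * n + 1)%:R :> R by rewrite ler1n addn1.
have := ln_le_sqrt _ _ k11; have := ln_ge0 k11.
have n1R : 1 <= n%:R :> R by rewrite ler1n.
have : Num.sqrt (3 * n + 1)%:R <= 2 * Num.sqrt n%:R :> R.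
  by apply: sqrt_le_double => //; rewrite natrD kE; lra.
have : Num.sqrt (3 * n)%:R <= 2 * Num.sqrt n%:R :> R.
  by apply: sqrt_le_double => //; rewrite kE; lra.
have : 1 <= Num.sqrt n%:R :> R by rewrite -[leLHS](@sqrtr1 R) ler_wsqrtr.
rewrite kE lnM ?posrE // !ler_norml => s1 s3 s31 l0 l1 lf.
by apply/andP; split; lra.
Qed.

Theorem proposition6p2 (R : realType) (s : nat -> R)
    (hs : symmetric_moments (bstar R) s) :
  let th : R := theta R in
  let a : R := th ^+ 3 in
  let e : R := expR 1 in
  [/\ exists K1 K2 : R, [/\ 0 < K1, 0 < K2 &
        forall n : nat, (1 <= n)%N ->
          K1 * a ^- n * Gamma (3 * n%:R + 3 / 2) < s (2 * n)%N /\
          s (2 * n)%N < K2 * a ^- n * n%:R * Gamma (3 * n%:R + 3 / 2)],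
      (fun n : nat => s (2 * n)%N `^ (n%:R^-1) / n%:R ^+ 3) @ \oo
        --> 27 / (a * e ^+ 3),
      27 / (a * e ^+ 3) = (3 / (e * th)) ^+ 3 &
      (fun n : nat => Useq (bstar R) s n `^ (n%:R^-1)) @ \oo
        --> (2 / th) ^+ 3].
Proof.
move=> th a e; have [a' [a06 Ea E_gt0]] := dixonE_first_zero R.
have aE : a = a' by rewrite /a /th (theta_cube _ _ a06 Ea E_gt0).
rewrite -{}aE in a06 Ea E_gt0.
have aE : a = th ^+ 3 by [].
clearbody a.
have a0 : 0 < a by case/andP: a06.
have th0 : th != 0.
  by apply/eqP => t0; move: a0; rewrite aE t0 expr0n ltxx.
have bnd n := dixon_moment_bounds R a s a06 Ea hs n.
have sE n : s (2 * n)%N = dixon_moment R s n * a ^+ n * a ^- n * (3 * n + 1)`!%:R.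
  by rewrite mulfK ?expf_neq0 ?gt_eqF // /dixon_moment divfK // gt_eqF // ltr0n fact_gt0.
have s0 n : 0 < s (2 * n)%N.
  rewrite sE; case/andP: (bnd n); move: (_ * a ^+ n) => d d1 _.
  by rewrite mulr_gt0 ?divr_gt0 ?exprn_gt0 ?ltr0n ?fact_gt0 //; lra.
have eN : expR 1 != 0 :> R by rewrite gt_eqF ?expR_gt0.
have eK : expR (3 * ln 3 - 3 - ln a) = 27 / (a * e ^+ 3).
  have e3 : expR 3 = e ^+ 3 by rewrite /e -expRM_natl mulr1.
  rewrite !expRB e3 expRM_natl !lnK ?posrE //.
  by field; rewrite eN gt_eqF.
have ls n (n1 : (1 <= n)%N) := ln_moment_estimate R a s n a0 n1 (bnd n).
split.
(* For K_1: Gamma <= 2 (3n+1)! and 34/143 > 2/10. For K_2: 3n + 1 <= 4n, (3n)! <= 2 Gamma and 8 *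
   252/143 < 15. *)
- exists (1 / 10), 15; split; [lra | lra | move=> n n1].
  have k2 : (2 <= 3 * n)%N by lia.
  have /andP[] := Gamma_half_bounds R (3 * n) k2; rewrite natrM.
  move: (Gamma _) => G Glo Ghi.
  have /andP[d1 d2] := bnd n; rewrite sE.
  have an : 0 < a ^- n by rewrite invr_gt0 exprn_gt0.
  move: (dixon_moment R s n * a ^+ n) d1 d2 => d d1 d2.
  have fE : (3 * n + 1)`!%:R = (3 * n%:R + 1) * (3 * n)`!%:R :> R.
    by rewrite addn1 factS natrM -[(3 * n).+1]addn1 natrD natrM.
  have f0 : 0 < (3 * n)`!%:R :> R by rewrite ltr0n fact_gt0.
  have n1R : 1 <= n%:R :> R by rewrite ler1n.
  rewrite addn1 in fE; rewrite addn1; split.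
  + rewrite [ltLHS](_ : _ = a ^- n * (1 / 10 * G)); last by ring.
    rewrite [ltRHS](_ : _ = a ^- n * (d * (3 * n).+1`!%:R)); last by ring.
    rewrite ltr_pM2l //.
    have F0 : 0 < (3 * n).+1`!%:R :> R by rewrite ltr0n fact_gt0.
    by nra.
  + rewrite [ltRHS](_ : _ = a ^- n * (15 * n%:R * G)); last by ring.
    rewrite [ltLHS](_ : _ = a ^- n * (d * (3 * n).+1`!%:R)); last by ring.
    rewrite ltr_pM2l // fE.
    apply: (@le_lt_trans _ _ (252 / 143 * ((4 * n%:R) * (2 * G)))).
      by apply: ler_pM; [lra | rewrite mulr_ge0 //; lra | lra | apply: ler_pM; lra].
    have : 0 < n%:R * G by apply: mulr_gt0; lra.
    lra.
- rewrite -eK; apply: (cvg_powR_root _ _ 3 _ 14) => n n1; [exact: s0 | exact: ls].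
- by rewrite aE; field; rewrite th0.
- rewrite (_ : (2 / th) ^+ 3 = expR (3 * ln 2 - ln a)); last first.
    by rewrite expRB lnK ?posrE // expRM_natl lnK ?posrE // aE; field.
  have P0 n : 0 < \prod_(i < n) bstar R i ^+ 2.
    by apply: prodr_gt0 => i _; rewrite exprn_even_gt0 // bstar_neq0.
  rewrite (_ : (fun n => _) = (fun n => Useq (bstar R) s n `^ n%:R^-1 / n%:R ^+ 0)); last first.
    by apply/funext => n; rewrite expr0 divr1.
  (* The terms 3 ln n cancel between the moment and the product, as do the -3; what remains of the
     constants is 3 ln 3 - 3 ln(3/2) - ln a = 3 ln 2 - ln a. The errors add up to 14 + 21 = 35. *)
  apply: (cvg_powR_root _ _ 0 _ 35) => n n1.
    by rewrite /Useq divr_gt0.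
  rewrite /Useq ln_div ?posrE //; have := ls n n1; have := ln_bstar_prod R n n1.
  rewrite ln_div ?posrE //.
  rewrite !ler_norml; move: n%:R (ln n%:R) (Num.sqrt n%:R) => t y r.
  by move=> /andP[p1 p2] /andP[q1 q2]; apply/andP; split; lra.
Qed.
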